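(* Let $n\ge 1$, $M\ge 2$, let $\mathbf{s}_1,\dots,\mathbf{s}_M\in\mathbb{R}^n$ be distinct points with $\frac1M\sum_{k=1}^M|\mathbf{s}_k|^2=1$, and let $i\neq j$ be indices in $\{1,\dots,M\}$. For $\gamma>0$ let $P_{ij}(\gamma)=\Pr\{\mathbf{s}_i\to\mathbf{s}_j\}$ be the pairwise error probability at SNR $\gamma$ of the maximum likelihood detector in the AWGN channel, and let $d_{ij}=|\mathbf{s}_i-\mathbf{s}_j|$ be the distance between $\mathbf{s}_i$ and $\mathbf{s}_j$. Then: (a) For any $n$, $P_{ij}$ is a convex function of the SNR $\gamma$ in the high SNR region $\gamma\ge (n+\sqrt{2n})/d_{\min,i}^2$. (b) For $n=1,2$, $P_{ij}$ is a concave function of $\gamma$ in the low SNR region $\gamma\le (n+\sqrt{2n})/(d_{ij}+d_{\max,j})^2$, and there is an odd number of inflection points, $P_{ij}''=0$, in the intermediate SNR range $$\frac{n+\sqrt{2n}}{(d_{ij}+d_{\max,j})^2}\le\gamma\le\frac{n+\sqrt{2n}}{d_{\min,i}^2}.$$ (c) For $n>2$, $P_{ij}$ is a convex function of $\gamma$ in the low SNR region $\gamma\le (n-\sqrt{2n})/(d_{ij}+d_{\max,j})^2$, and there is an even number of inflection points in the intermediate SNR range $$\frac{n-\sqrt{2n}}{(d_{ij}+d_{\max,j})^2}\le\gamma\le\frac{n+\sqrt{2n}}{d_{\min,i}^2}.$$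
   Context: Channel model: $\mathbf{r}=\mathbf{s}+\boldsymbol{\xi}$ in $\mathbb{R}^n$, where $\mathbf{s}\in\{\mathbf{s}_1,\dots,\mathbf{s}_M\}$ is the transmitted constellation point and $\boldsymbol{\xi}\sim\mathcal{N}(\mathbf{0},\sigma_0^2\mathbf{I})$ is additive white Gaussian noise with density $p_\xi(\mathbf{x})=(2\pi\sigma_0^2)^{-n/2}e^{-|\mathbf{x}|^2/(2\sigma_0^2)}$; $|\cdot|$ is the Euclidean norm. The SNR is $\gamma=1/\sigma_0^2$. The constellation is arbitrary but fixed, and $\gamma$ varies. The maximum likelihood detector is the minimum distance detector $\hat{\mathbf{s}}=\arg\min_{\mathbf{s}_k}|\mathbf{r}-\mathbf{s}_k|$. The decision (Voronoi) region of $\mathbf{s}_k$ is the convex polyhedron $V_k=\{\mathbf{y}\in\mathbb{R}^n: |\mathbf{y}-\mathbf{s}_k|\le|\mathbf{y}-\mathbf{s}_l|\ \text{for all } l\}$. The pairwise error probability is $\Pr\{\mathbf{s}_i\to\mathbf{s}_j\}=\Pr[\hat{\mathbf{s}}=\mathbf{s}_j\mid\mathbf{s}=\mathbf{s}_i]=\int_{V_j-\mathbf{s}_i}p_\xi(\mathbf{x})\,d\mathbf{x}$, where $V_j-\mathbf{s}_i$ is $V_j$ in the reference frame centered at $\mathbf{s}_i$. $d_{\min,k}$ is the minimum distance from $\mathbf{s}_k$ to the boundary of its decision region $V_k$, i.e. $d_{\min,k}=\frac12\min_{l\ne k}|\mathbf{s}_l-\mathbf{s}_k|$. $d_{\max,k}$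 is the maximum distance from $\mathbf{s}_k$ to the boundary of its decision region $V_k$. Primes denote derivatives with respect to $\gamma$; inflection points are indicated by the condition $P_{ij}''=0$.
   Formalization: Parts (b) and (c) are stated for a bounded decision region V_j, as otherwise d_max,j is infinite or (n=1, s=±1) the claims fail since P_ij=Q(√γ) is convex without inflection; inflection points are zeros of P_ij'' where it changes sign. *)

(* Defs.v *)
From HB Require Import structures.
From mathcomp Require Import all_boot all_order all_algebra.
From mathcomp Require Import all_classical all_reals all_analysis.

Set Implicit Arguments.
Unset Strict Implicit.
Unset Printing Implicit Defensive.

Import Order.TTheory GRing.Theory Num.Theory.
Import numFieldNormedType.Exports.

Local Open Scope classical_set_scope.
Local Open Scope ring_scope.

(* The library provides binary product measures only, so Lebesgue measure on
   R^n (as n-tuples) is built by iterating lebesgue_measure \x _, transported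
   along (x, t) |-> x :: t.  The n-tuples carry the library's product
   sigma-algebra. *)
Section lebesgue_cons.
Context {R : realType} (n : nat).
Variable m : {sigma_finite_measure set (n.-tuple R) -> \bar R}.

Definition tcons (p : measurableTypeR R * n.-tuple R) : n.+1.-tuple R := [tuple of p.1 :: p.2].

Definition tuncons (t : n.+1.-tuple R) :
    measurableTypeR R * n.-tuple R :=
  (thead t, [tuple of behead t]).

Lemma tconsK : cancel tcons tuncons.
Proof. by case=> x t; congr (_, _); apply/val_inj. Qed.

Lemma measurable_tcons : measurable_fun setT tcons.
Proof. exact: measurable_cons. Qed.

Lemma measurable_tuncons : measurable_fun setT tuncons.
Proof.
apply/measurable_fun_pairP; split; first exact: measurable_tnth.
exact: measurable_behead.
Qed.

Definition lebesgue_cons : set (n.+1.-tuple R) -> \bar R :=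
  pushforward (@lebesgue_measure R \x m)%E tcons.

Let lebesgue_cons0 : lebesgue_cons set0 = 0%E.
Proof. by rewrite /lebesgue_cons /pushforward preimage_set0 measure0. Qed.

Let lebesgue_cons_ge0 A : (0 <= lebesgue_cons A)%E.
Proof. by rewrite /lebesgue_cons /pushforward; exact: measure_ge0. Qed.

Let lebesgue_cons_sigma_additive : semi_sigma_additive lebesgue_cons.
Proof.
rewrite /lebesgue_cons.
apply: measure_semi_sigma_additive; exact: measurable_tcons.
Qed.

HB.instance Definition _ := isMeasure.Build _ _ _ lebesgue_cons
  lebesgue_cons0 lebesgue_cons_ge0 lebesgue_cons_sigma_additive.

Let lebesgue_cons_sigma_finite : sigma_finite setT lebesgue_cons.
Proof.
have /sigma_finiteP[F [TF ndF Foo]] := sigma_finiteT (@lebesgue_measure R).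
have /sigma_finiteP[G [TG ndG Goo]] := sigma_finiteT m.
exists (fun k => tuncons @^-1` (F k `*` G k)).
  apply/esym/seteqP; split=> // t _.
  have [k _ Fk] : (\bigcup_k F k) (tuncons t).1 by rewrite -TF.
  have [l _ Gl] : (\bigcup_k G k) (tuncons t).2 by rewrite -TG.
  exists (maxn k l) => //; split.
  - by apply: subsetPset Fk; exact/ndF/leq_maxl.
  - by apply: subsetPset Gl; exact/ndG/leq_maxr.
move=> k; have [mF Fk] := Foo k; have [mG Gk] := Goo k.
split.
  rewrite -[X in measurable X]setTI; apply: measurable_tuncons => //.
  exact: measurableX.
rewrite /lebesgue_cons /pushforward -comp_preimage.
rewrite (_ : tuncons \o tcons = id); last by apply/funext => p /=; rewrite tconsK.
by rewrite preimage_id product_measure1E// lte_mul_pinfty// ge0_fin_numE.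
Qed.

HB.instance Definition _ := Measure_isSigmaFinite.Build _ _ _ lebesgue_cons
  lebesgue_cons_sigma_finite.

End lebesgue_cons.

Fixpoint lebesgue_tuple (R : realType) (n : nat) :
    {sigma_finite_measure set (n.-tuple R) -> \bar R} :=
  if n is n'.+1 then lebesgue_cons (lebesgue_tuple R n')
  else @dirac _ _ [tuple] R.

Section awgn.
Variable R : realType.
Implicit Types n M : nat.

(* The norm that the library puts on 'rV[R]_n is the sup norm. *)
Definition enorm n (x : 'rV[R]_n) : R := Num.sqrt (\sum_i x 0 i ^+ 2).

Definition row_of_tuple n (t : n.-tuple R) : 'rV[R]_n := \row_i tnth t i.

(* The topology on 'rV[R]_n is the product topology, i.e. the Euclidean one. *)
Definition boundary n (A : set 'rV[R]_n) : set 'rV[R]_n := closure A `\` A°.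

Definition voronoi n M (s : 'I_M -> 'rV[R]_n) (k : 'I_M) : set 'rV[R]_n :=
  [set y | forall l, enorm (y - s k) <= enorm (y - s l)].

Definition boundary_dist n M (s : 'I_M -> 'rV[R]_n) (k : 'I_M) : set R :=
  [set enorm (y - s k) | y in boundary (voronoi s k)].

Definition dmin n M (s : 'I_M -> 'rV[R]_n) (k : 'I_M) : R :=
  inf (boundary_dist s k).

(* Meaningful only when the decision region is bounded: otherwise the maximal
   distance is infinite, and sup is a junk value (or, for a half-line in R^1,
   the distance to its endpoint). *)
Definition dmax n M (s : 'I_M -> 'rV[R]_n) (k : 'I_M) : R :=
  sup (boundary_dist s k).

(* v is the noise variance per dimension. *)
Definition awgn_pdf n (v : R) (x : 'rV[R]_n) : R :=
  (2 * pi * v) `^ (- (n%:R / 2)) * expR (- (enorm x ^+ 2 / (2 * v))).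

(* The noise variance is 1 / gamma, and the domain of integration is the region
   of s_j in the frame centered at s_i. *)
Definition pep n M (s : 'I_M -> 'rV[R]_n) (i j : 'I_M) (gamma : R) : R :=
  (\int[lebesgue_tuple R n]_(t in [set t | voronoi s j (s i + row_of_tuple t)])
     awgn_pdf gamma^-1 (row_of_tuple t))%R.

Definition concave_function (D : set R) (f : R -> R) : Prop :=
  convex_function (E := R^o) D (\- f).

(* f'' vanishes and changes sign: zeros of f'' at which the convexity does not
   switch (even multiplicity) are not inflection points. *)
Definition inflection_point (f : R -> R) (x : R) : Prop :=
  let f'' := derive1n 2 f in
  f'' x = 0 /\
  ((\forall y \near x^'-, f'' y < 0) /\ (\forall y \near x^'+, 0 < f'' y) \/
   (\forall y \near x^'-, 0 < f'' y) /\ (\forall y \near x^'+, f'' y < 0)).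

Definition inflection_points (f : R -> R) (a b : R) : set R :=
  [set x | a <= x <= b /\ inflection_point f x].

End awgn.

(* Main.v *)
Require Import Defs.
From mathcomp Require Import all_boot all_order all_algebra.
From mathcomp Require Import all_classical all_reals all_analysis.
From mathcomp Require Import measurable_realfun ring lra.

Set Implicit Arguments.
Unset Strict Implicit.
Unset Printing Implicit Defensive.

Import Order.TTheory GRing.Theory Num.Theory.
Import numFieldNormedType.Exports.

Local Open Scope classical_set_scope.
Local Open Scope ring_scope.

(** With p = n/2, A = V_j - s_i and u(x) = |x|^2/2, the error probability is
    P(g) = (2 pi)^(-p) \int_A g^p e^(-g u), and the second derivative in g of
    g^p e^(-g u) is g^(p-2) e^(-g u) ((g u - p)^2 - p).  Its sign is constant
    on A when g |x|^2 is beyond n + sqrt(2n) or below n - sqrt(2n), and on A the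
    segment from s_i to s_i + x leaves V_i, so that dmin_i <= |x|, while
    |x| <= d_ij + dmax_j by the triangle inequality.  Convexity and concavity
    follow by integrating the pointwise inequalities.

    When V_j is bounded, g^(2-p) P''(g) is a positive multiple of H(g), a
    combination of the moments L_k(g) = \int_A u^k e^(-g u), and the derivatives
    of H at any given point cannot all vanish.  Hence H has a definite sign on
    each side of every point, its sign changes in a compact interval are
    finitely many, and their parity is read off the signs at the endpoints. *)

(** * Sign changes on an interval *)

Section sign_changes.
Variable R : realType.
Implicit Types (F : R -> R) (x y z : R) (b c : bool).

Lemma near_rightP x (P : set R) :
  (\forall y \near x^'+, P y) <-> exists2 e, 0 < e & forall y, x < y < x + e -> P y.
Proof.
split=> [|[e e0 Pe]].
  move=> [e /= e0 Pe]; exists e => // y /andP[xy ye]; apply: Pe => //=.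
  by rewrite ltr0_norm ?subr_lt0//; lra.
exists e => //= y /=; rewrite ltr_norml => ye xy; apply: Pe; lra.
Qed.

Lemma near_leftP x (P : set R) :
  (\forall y \near x^'-, P y) <-> exists2 e, 0 < e & forall y, x - e < y < x -> P y.
Proof.
split=> [|[e e0 Pe]].
  move=> [e /= e0 Pe]; exists e => // y /andP[ye yx]; apply: Pe => //=.
  by rewrite gtr0_norm ?subr_gt0//; lra.
exists e => //= y /=; rewrite ltr_norml => ye xy; apply: Pe; lra.
Qed.

(** Signs are booleans, [true] for negative, so that the sign of a product is an exclusive or and a
    number of sign changes can be compared with [odd]. *)
Definition has_sign b (r : R) := 0 < (-1) ^+ b * r.

Lemma has_sign_neq0 b r : has_sign b r -> r != 0.
Proof. by apply: contraTneq => ->; rewrite /has_sign mulr0 ltxx. Qed.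

Lemma has_sign_uniq b c r : has_sign b r -> has_sign c r -> b = c.
Proof. by case: b; case: c; rewrite /has_sign ?expr1 ?expr0; lra. Qed.

Lemma neq0_has_sign (r : R) : r != 0 -> exists b, has_sign b r.
Proof.
rewrite neq_lt => /orP[r0|r0]; [exists true|exists false];
  rewrite /has_sign ?expr1 ?expr0; lra.
Qed.

Lemma has_signM b c (r t : R) : has_sign b r -> has_sign c t ->
  has_sign (b (+) c) (r * t).
Proof. by move=> rb tc; rewrite /has_sign signr_addb mulrACA mulr_gt0. Qed.

Lemma continuous_has_sign F x b : {for x, continuous F} -> has_sign b (F x) ->
  exists2 e, 0 < e & forall y, x - e < y < x + e -> has_sign b (F y).
Proof.
move=> cF Fx.
have /(cvgr_gt ((-1) ^+ b * F x)) /(_ _ Fx) [e /= e0 He] :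
  (fun y => (-1) ^+ b * F y) y @[y --> x] --> (-1) ^+ b * F x.
  by apply: cvgM; [exact: cvg_cst|exact: cF].
exists e => // y ye; apply: He => /=; rewrite ltr_norml; lra.
Qed.

(** The value at [x] itself is left free: it may vanish whether or not the sign flips there. *)
Definition two_sided_sign F x bl br :=
  exists2 e, 0 < e &
    (forall y, x - e < y < x -> has_sign bl (F y)) /\
    (forall y, x < y < x + e -> has_sign br (F y)).

(** If [F x] is nonzero, continuity gives one sign on both sides. If it is zero, the mean value
    theorem writes [F y] as [F' z * (y - x)], so [F] inherits the sign of [F'] on the right and the
    opposite one on the left. *)
Lemma two_sided_sign_primitive F F' x :
    (forall y, is_derive y 1 F (F' y)) ->
  (exists bl br, two_sided_sign F' x bl br) -> exists bl br, two_sided_sign F x bl br.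
Proof.
move=> dF [bl [br [e e0 [Hl Hr]]]].
have cF y : {for y, continuous F}.
  by apply/differentiable_continuous/derivable1_diffP.
have [Fx0|/neq0_has_sign[b Fxb]] := eqVneq (F x) 0; last first.
  have [e' e'0 He] := continuous_has_sign (@cF x) Fxb.
  exists b, b, e' => //; split=> y ye; apply: He; lra.
exists (bl (+) true), br, e => //; split=> y ye.
- have [||z] := @MVT _ F F' y x.
  + by lra.
  + by apply: continuous_subspaceT => w; exact: cF.
  rewrite in_itv/= Fx0 sub0r => yz Fy.
  have -> : F y = F' z * (y - x) by rewrite -[LHS]opprK Fy; ring.
  apply: has_signM; first by apply: Hl; lra.
  by rewrite /has_sign expr1; lra.
- have [||z] := @MVT _ F F' x y.
  + by lra.
  + by apply: continuous_subspaceT => w; exact: cF.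
  rewrite in_itv/= Fx0 subr0 => yz ->.
  rewrite -[br]addbF; apply: has_signM; first by apply: Hr; lra.
  by rewrite /has_sign expr0; lra.
Qed.

(** The function of index [K] has a sign around [x] by continuity; taking primitives [K] times
    brings this down to [H 0]. *)
Lemma two_sided_sign_derivatives (H : nat -> R -> R) K x :
    (forall k y, is_derive y 1 (H k) (H k.+1 y)) ->
  H K x != 0 -> exists bl br, two_sided_sign (H 0) x bl br.
Proof.
move=> dH HK; pose Q k := exists bl br, two_sided_sign (H k) x bl br.
have QK : Q K.
  have [b Fxb] := neq0_has_sign HK.
  have [|e e0 He] := @continuous_has_sign (H K) x b _ Fxb.
    by apply/differentiable_continuous/derivable1_diffP.
  exists b, b, e => //; split=> y ye; apply: He; lra.
rewrite -/(Q 0%N); elim: K QK {HK} => // K IH QK; apply: IH.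
exact: two_sided_sign_primitive QK.
Qed.

(** This has the shape of [inflection_point] with [F] in place of the second derivative, so the two
    agree by conversion when [F] is [derive1n 2 f]. *)
Definition sign_change F x :=
  F x = 0 /\
  ((\forall y \near x^'-, F y < 0) /\ (\forall y \near x^'+, 0 < F y) \/
   (\forall y \near x^'-, 0 < F y) /\ (\forall y \near x^'+, F y < 0)).

(** Two signs valid on left neighbourhoods of [x] are compared at one point of the smaller
    neighbourhood. *)
Lemma near_left_has_sign F x bl br b : two_sided_sign F x bl br ->
  (\forall y \near x^'-, has_sign b (F y)) <-> bl = b.
Proof.
case=> e e0 [Hl _]; split=> [/near_leftP[e' e'0 Hb]|<-]; last first.
  by apply/near_leftP; exists e.
have me : 0 < Num.min e e' by rewrite lt_min e0.
have [? ?] : Num.min e e' <= e /\ Num.min e e' <= e' by rewrite !ge_min !lexx orbT.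
apply: (@has_sign_uniq _ _ (F (x - Num.min e e' / 2)));
  [apply: Hl|apply: Hb]; lra.
Qed.

Lemma near_right_has_sign F x bl br b : two_sided_sign F x bl br ->
  (\forall y \near x^'+, has_sign b (F y)) <-> br = b.
Proof.
case=> e e0 [_ Hr]; split=> [/near_rightP[e' e'0 Hb]|<-]; last first.
  by apply/near_rightP; exists e.
have me : 0 < Num.min e e' by rewrite lt_min e0.
have [? ?] : Num.min e e' <= e /\ Num.min e e' <= e' by rewrite !ge_min !lexx orbT.
apply: (@has_sign_uniq _ _ (F (x + Num.min e e' / 2)));
  [apply: Hr|apply: Hb]; lra.
Qed.

(** Continuity supplies the condition [F x = 0]: a nonzero value would force [bl] and [br] to be
    equal. *)
Lemma sign_changeE F x bl br : {for x, continuous F} ->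
  two_sided_sign F x bl br -> sign_change F x <-> bl (+) br.
Proof.
move=> cF sF.
have E0 (r : R) : (0 < r) = has_sign false r by rewrite /has_sign expr0 mul1r.
have E1 (r : R) : (r < 0) = has_sign true r.
  by rewrite /has_sign expr1 mulN1r oppr_gt0.
have lP b := near_left_has_sign b sF; have rP b := near_right_has_sign b sF.
have lN : (\forall y \near x^'-, F y < 0) <-> bl = true.
  by rewrite -lP; split; apply: filterS => y; rewrite E1.
have lp : (\forall y \near x^'-, 0 < F y) <-> bl = false.
  by rewrite -lP; split; apply: filterS => y; rewrite E0.
have rN : (\forall y \near x^'+, F y < 0) <-> br = true.
  by rewrite -rP; split; apply: filterS => y; rewrite E1.
have rp : (\forall y \near x^'+, 0 < F y) <-> br = false.
  by rewrite -rP; split; apply: filterS => y; rewrite E0.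
rewrite /sign_change lN lp rN rp; split=> [[_ [] [-> ->]]//|blr]; split; last first.
  by case: bl br blr {sF lP rP lN lp rN rp} => -[]// _; [left|right].
apply/eqP; apply: contraTT blr => /neq0_has_sign[b Fxb].
have [e e0 He] := continuous_has_sign cF Fxb.
have -> : bl = b by apply/lP/near_leftP; exists e => // y ye; apply: He; lra.
have -> : br = b by apply/rP/near_rightP; exists e => // y ye; apply: He; lra.
by rewrite addbb.
Qed.

(** * Parity of the number of sign changes, by induction along the interval *)

Section parity.
Variables (F : R -> R) (a b : R) (ea : bool).
Hypotheses (ab : a <= b) (cF : forall x, a <= x <= b -> {for x, continuous F}).
Hypothesis sF : forall x, a <= x <= b -> exists bl br, two_sided_sign F x bl br.
Hypothesis Fa : has_sign ea (F a).

Let scs x := [set y | a <= y <= x /\ sign_change F y].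

(** The invariant of the induction: finitely many changes have occurred up to [x], and their parity
    compares the sign at [a] with the sign just after [x]. *)
Let T x := a <= x <= b /\ exists m bl br,
  [/\ two_sided_sign F x bl br, odd m = ea (+) br & (scs x #= `I_m)%card].

(** No change occurs strictly between [y] and [z], so only [z] can be added; when it is, the
    cardinal and the sign on the right flip together. *)
Let T_step y z c : T y -> y < z -> z <= b ->
  (forall w, y < w < z -> has_sign c (F w)) -> T z.
Proof.
move=> [aby [m [bl [br [sy om cm]]]]] yz zb Hc.
have abz : a <= z <= b by lra.
split=> //.
have [cl [cr sz]] := sF abz.
have brc : br = c.
  by apply/(near_right_has_sign _ sy)/near_rightP; exists (z - y) => [|w]; [lra|];
     move=> yw; apply: Hc; lra.
have clc : cl = c.
  by apply/(near_left_has_sign _ sz)/near_leftP; exists (z - y) => [|w]; [lra|];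
     move=> yw; apply: Hc; lra.
have scsE : scs z = scs y `|` (if cl (+) cr then [set z] else set0).
  apply/seteqP; split=> w.
    move=> [azw scw].
    have [wy|yw] := leP w y; first by left; split=> //; lra.
    have [wz|zw] := ltP w z.
      have /Hc/has_sign_neq0 : y < w < z by rewrite yw.
      by case: scw => ->; rewrite eqxx.
    have wz : w = z by lra.
    right; move: scw; rewrite wz => /(sign_changeE (cF abz) sz) ->.
    exact: erefl.
  case=> [[ayw scw]|]; first by split=> //; lra.
  case: ifP => // clr -> /=; split; first by lra.
  exact/(sign_changeE (cF abz) sz).
exists (m + (cl (+) cr))%N, cl, cr; split=> //.
  by rewrite oddD om oddb brc clc; case: (ea) (c) cr {sz scsE} => -[] -[].
rewrite scsE; case: ifP => clr /=; last by rewrite setU0 addn0.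
rewrite addn1; apply/eq_cardSP; exists z; first by right.
rewrite setDUl setDv setU0 (_ : scs y `\ z = scs y)//.
apply/seteqP; split=> w; first by case.
by move=> [ayw scw]; split=> //= wz; lra.
Qed.

(** Real induction: the supremum of [T] lies in [T] by the constant sign on its left, and equals [b]
    by the constant sign on its right. *)
Lemma sign_changes_parity eb : has_sign eb (F b) ->
  exists2 m, odd m = ea (+) eb &
    ([set x | a <= x <= b /\ sign_change F x] #= `I_m)%card.
Proof.
move=> Fb.
have Ta : T a.
  have aab : a <= a <= b by rewrite lexx ab.
  split=> //; have [bl [br sa]] := sF aab.
  have [e e0 He] := continuous_has_sign (cF aab) Fa.
  have ble : bl = ea.
    by apply/(near_left_has_sign _ sa)/near_leftP; exists e => // y ye; apply: He; lra.
  have bre : br = ea.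
    by apply/(near_right_has_sign _ sa)/near_rightP; exists e => // y ye; apply: He; lra.
  exists 0%N, bl, br; split=> //; first by rewrite bre addbb.
  rewrite (_ : scs a = set0) ?II0//; apply/seteqP; split=> // y [aya [Fy0 _]].
  have ya : y = a by lra.
  by move/has_sign_neq0: Fa; rewrite -ya Fy0 eqxx.
have supT : has_sup T by split; [exists a|exists b => y [/andP[]]].
set z := sup T.
have az : a <= z by apply: ub_le_sup => //; case: supT.
have zb : z <= b by apply: ge_sup => [|y [/andP[]]//]; exists a.
have abz : a <= z <= b by lra.
have Tz : T z.
  have [bl [br [e e0 [Hl Hr]]]] := sF abz.
  (* A point of [T] this close to [z] reaches [z] in one step. *)
  have [y Ty zey] := sup_adherent e0 supT.
  have : y <= z by apply: ub_le_sup => //; case: supT.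
  rewrite le_eqVlt => /predU1P[<-//|yz].
  apply: (T_step Ty yz zb) => w yw; apply: Hl.
  by rewrite -/z in zey; lra.
have {}zb : z = b.
  apply/eqP; rewrite eq_le zb/= leNgt; apply/negP => ltzb.
  have [bl [br [e e0 [Hl Hr]]]] := sF abz.
  have [le1 le2] : Num.min (z + e / 2) b <= z + e / 2 /\ Num.min (z + e / 2) b <= b.
    by rewrite !ge_min !lexx orbT.
  have lt1 : z < Num.min (z + e / 2) b by rewrite lt_min; lra.
  (* One more step would pass beyond the supremum. *)
  have : T (Num.min (z + e / 2) b).
    by apply: (T_step Tz lt1 le2) => w yw; apply: Hr; lra.
  by move/(ub_le_sup supT.2); rewrite -/z; lra.
have [_ [m [bl [br [sz om cm]]]]] := Tz; exists m; last by rewrite -zb.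
(* The sign just after [b] is that of [F b], by continuity. *)
rewrite om; congr (_ (+) _); apply/(near_right_has_sign _ sz)/near_rightP.
rewrite zb in abz *; have [e e0 He] := continuous_has_sign (cF abz) Fb.
by exists e => // y ye; apply: He; lra.
Qed.
End parity.

End sign_changes.

(** * Laplace moments *)

Section derivatives.
Variable R : realType.

Lemma is_derive_mul (f g : R -> R) (x df dg : R) :
  is_derive x 1 f df -> is_derive x 1 g dg ->
  is_derive x 1 (fun y => f y * g y) (df * g x + f x * dg).
Proof.
move=> hf hg; apply: (is_derive_eq (is_deriveM hf hg)).
by rewrite /GRing.scale/= addrC [g x * df]mulrC.
Qed.

Lemma is_derive_add (f g : R -> R) (x df dg : R) :
  is_derive x 1 f df -> is_derive x 1 g dg ->
  is_derive x 1 (fun y => f y + g y) (df + dg).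
Proof. by move=> hf hg; apply: is_deriveD. Qed.

Lemma is_derive_scale (c : R) (f : R -> R) (x df : R) :
  is_derive x 1 f df -> is_derive x 1 (fun y => c * f y) (c * df).
Proof.
by move=> hf; apply: (is_derive_eq (is_derive_mul (is_derive_cst c x 1) hf)); rewrite mul0r add0r.
Qed.

Lemma is_derive_expN (u x : R) :
  is_derive x 1 (fun y => expR (- (y * u))) (- u * expR (- (x * u))).
Proof.
have h : is_derive x 1 (fun y => - (y * u)) (- u).
  have -> : (fun y => - (y * u)) = (fun y => - u * y) by apply/funext => y; ring.
  by apply: (is_derive_eq (is_derive_scale (- u) (is_derive_id x 1))); rewrite mulr1.
apply: is_derive_eq (@is_derive1_comp _ expR _ x _ _ (is_derive_expR _) h) _.
by rewrite mulrC.
Qed.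

Lemma derive_powR_mul (p x : R) (L0 L1 : R -> R) : 0 < x ->
  is_derive x 1 L0 (- L1 x) ->
  is_derive x 1 (fun y => y `^ p * L0 y) (x `^ (p - 1) * (p * L0 x - x * L1 x)).
Proof.
move=> x0 dL0; apply: (is_derive_eq (is_derive_mul (is_derive1_powR p x0) dL0)).
have -> : x `^ p = x `^ (p - 1) * x.
  by rewrite -[X in _ * X]powRr1 ?ltW// -powRD ?subrK// (gt_eqF x0) implybT.
ring.
Qed.

(** The function is the first derivative found in [derive_powR_mul]. For moments of [u], the new
    bracket integrates [(x u - p)^2 - p] against [e^(-x u)]. *)
Lemma derive2_powR_mul (p x : R) (L0 L1 L2 : R -> R) : 0 < x ->
  is_derive x 1 L0 (- L1 x) -> is_derive x 1 L1 (- L2 x) ->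
  is_derive x 1 (fun y => y `^ (p - 1) * (p * L0 y - y * L1 y))
   (x `^ (p - 2) * (p * (p - 1) * L0 x - 2 * p * x * L1 x + x ^+ 2 * L2 x)).
Proof.
move=> x0 dL0 dL1.
have d2 : is_derive x 1 (fun y => p * L0 y - y * L1 y)
    (- ((p + 1) * L1 x - x * L2 x)).
  have -> : (fun y => p * L0 y - y * L1 y) = (fun y => p * L0 y + (-1) * (y * L1 y)).
    by apply/funext => y; ring.
  apply: (is_derive_eq (is_derive_add (is_derive_scale p dL0)
    (is_derive_scale (-1) (is_derive_mul (is_derive_id x 1) dL1)))).
  ring.
apply: (is_derive_eq (is_derive_mul (is_derive1_powR (p - 1) x0) d2)).
have -> : p - 1 - 1 = p - 2 by ring.
have -> : x `^ (p - 1) = x `^ (p - 2) * x.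
  rewrite -[X in _ * X]powRr1 ?ltW// -powRD ?(gt_eqF x0) ?implybT//.
  by congr (_ `^ _); ring.
ring.
Qed.

End derivatives.

Section measure_lemmas.
Context d (T : measurableType d) (R : realType) (mu : {measure set T -> \bar R}).

(** A zero integral would make [f] vanish almost everywhere on [A], and [E] would then lie in a null
    set. *)
Lemma Rintegral_gt0 (A E : set T) (f : T -> R) :
  measurable A -> measurable E -> E `<=` A -> (0 < mu E)%E ->
  mu.-integrable A (EFin \o f) ->
  (forall t, A t -> 0 <= f t) -> (forall t, E t -> 0 < f t) ->
  0 < \int[mu]_(t in A) f t.
Proof.
move=> mA mE EA E0 intf f0 fE; rewrite lt_neqAle Rintegral_ge0// andbT eq_sym.
apply: contraTneq E0 => If0.
have fin := integrable_fin_num mA intf.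
have mf := measurable_int _ intf.
have /(ae_eq_integral_abs mu mA mf)[N [mN N0 subN]] :
    (\int[mu]_(x in A) `|(EFin \o f) x| = 0)%E.
  rewrite -[RHS](congr1 EFin If0) fineK//; apply: eq_integral => t /set_mem At /=.
  by rewrite ger0_norm// f0.
rewrite -leNgt -N0; apply: le_measure; rewrite ?inE// => t Et; apply: subN => /=.
by move/(_ (EA _ Et)) => -[ft0]; have := fE _ Et; rewrite ft0 ltxx.
Qed.

(** * Moments of a bounded function on a set of finite measure *)

Section laplace_moments.
Variables (A : set T) (u : T -> R) (B : R).
Hypotheses (mA : measurable A) (Afin : (mu A < +oo)%E).
Hypotheses (mu_u : measurable_fun A u) (uB : forall t, A t -> 0 <= u t <= B).

Definition laplace_moment (k : nat) (x : R) : R :=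
  \int[mu]_(t in A) (u t ^+ k * expR (- (x * u t))).

Local Notation L := laplace_moment.

Lemma laplace_moment_integrable k x :
  mu.-integrable A (EFin \o (fun t => u t ^+ k * expR (- (x * u t)))).
Proof.
apply: measurable_bounded_integrable => //.
  apply: measurable_funM; first exact: measurable_funX.
  apply: measurableT_comp => //; apply: measurableT_comp => //.
  exact: measurable_funM.
exists (B ^+ k * expR (`|x| * B)); split; first exact: num_real.
move=> M ltM t /= At; apply: le_trans (ltW ltM).
have /andP[u0 ub] := uB At.
rewrite normrM normrX (ger0_norm u0) ger0_norm ?expR_ge0//.
apply: ler_pM; rewrite ?exprn_ge0 ?expR_ge0//.
  by rewrite lerXn2r// nnegrE (le_trans u0).
rewrite ler_expR -mulNr; apply: (le_trans (ler_norm _)); rewrite normrM normrN ler_wpM2l//.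
by rewrite ger0_norm.
Qed.

(** Differentiation under the integral sign, with a constant dominating function since [u] is
    bounded and the parameter stays within distance 1 of [x]. *)
Lemma laplace_moment_derive k (x : R) :
  is_derive x 1 (L k) (- L k.+1 x).
Proof.
pose f y t : R := u t ^+ k * expR (- (y * u t)).
have df (y : R) t : is_derive y 1 (f ^~ t) (- (u t ^+ k.+1 * expR (- (y * u t)))).
  apply: (is_derive_eq (is_derive_scale (u t ^+ k) (is_derive_expN (u t) y))).
  by rewrite exprSr; ring.
(* Absolute values keep the bound nonnegative even if [A] is empty, when nothing fixes the sign of
   [B]. *)
pose G (t : T) := `|B| ^+ k.+1 * expR ((`|x| + 1) * `|B|).
have d1f y t : partial1of2 f y t = - (u t ^+ k.+1 * expR (- (y * u t))).
  by rewrite partial1of2E; apply: derive_val.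
have Ix : `]x - 1, x + 1[%classic x by rewrite /= in_itv/=; lra.
have intf y : `]x - 1, x + 1[%classic y -> mu.-integrable A (EFin \o f y).
  by move=> _; exact: laplace_moment_integrable.
have derf (y : R) t : `]x - 1, x + 1[%classic y -> A t -> derivable (f ^~ t) y 1.
  by move=> _ _; apply: ex_derive; exact: df.
have G0 t : 0 <= G t by rewrite mulr_ge0 ?exprn_ge0 ?expR_ge0.
have intG : mu.-integrable A (EFin \o G).
  apply: measurable_bounded_integrable => //; first exact: measurable_cst.
  exists (`|B| ^+ k.+1 * expR ((`|x| + 1) * `|B|)); split; first exact: num_real.
  by move=> M ltM t /= At; rewrite ger0_norm ?G0// ltW.
have Gub y t : `]x - 1, x + 1[%classic y -> A t -> `|partial1of2 f y t| <= G t.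
  rewrite /= in_itv/= d1f => yx At; have /andP[u0 ub] := uB At.
  have uB' := le_trans ub (ler_norm B).
  rewrite normrN normrM normrX (ger0_norm u0) ger0_norm ?expR_ge0//.
  apply: ler_pM; rewrite ?exprn_ge0 ?expR_ge0//; first by rewrite lerXn2r// nnegrE.
  rewrite ler_expR -mulNr; apply: (le_trans (ler_norm _)); rewrite normrM ler_pM//.
    rewrite normrN -[y](subrK x) addrC (le_trans (ler_normD _ _))// lerD2l.
    by rewrite ler_norml; lra.
  by rewrite ger0_norm.
have dv := derivable_under_integral mA Ix intf derf G0 intG Gub.
have := differentiation_under_integral mA Ix intf derf G0 intG Gub.
rewrite derive1E => De; apply: (@DeriveDef _ _ _ x 1 (L k) _ dv).
rewrite De; under eq_Rintegral do rewrite d1f -mulN1r.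
by rewrite RintegralZl ?mulN1r//; exact: laplace_moment_integrable.
Qed.

Lemma laplace_moment_leS k x : L k.+1 x <= B * L k x.
Proof.
rewrite -RintegralZl//; last exact: laplace_moment_integrable.
apply: le_Rintegral => //; first exact: laplace_moment_integrable.
  by have := integrableZl mA B (laplace_moment_integrable k x); exact: eq_integrable.
move=> t At; have /andP[u0 ub] := uB At.
by rewrite exprS -mulrA ler_wpM2r// mulr_ge0 ?expR_ge0 ?exprn_ge0.
Qed.

(* Up to the factor (-1)^k x^(p+k-2), the second derivative of x^(p+k) L_k(x). *)
Definition laplace_chain (p : R) k x :=
  (-1) ^+ k * ((p + k%:R) * (p + k%:R - 1) * L k x
               - 2 * (p + k%:R) * x * L k.+1 x + x ^+ 2 * L k.+2 x).

(** With [q = p + k], the coefficients recombine as [q (q - 1) + 2 q = (q + 1) q] and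
    [2 q + 2 = 2 (q + 1)]; the minus sign from each moment is absorbed by [(-1)^k]. *)
Lemma laplace_chain_derive p k (x : R) :
  is_derive x 1 (laplace_chain p k) (laplace_chain p k.+1 x).
Proof.
have dX := is_derive_id x 1.
have dL j := laplace_moment_derive j x.
set q := p + k%:R.
have -> : laplace_chain p k = (fun y => (-1) ^+ k * (q * (q - 1) * L k y +
    ((- 2 * q) * (y * L k.+1 y) + (y * y) * L k.+2 y))).
  by apply/funext => y; rewrite /laplace_chain -/q; congr (_ * _); ring.
apply: (is_derive_eq (is_derive_scale _ (is_derive_add (is_derive_scale _ (dL k))
   (is_derive_add (is_derive_scale _ (is_derive_mul dX (dL k.+1)))
     (is_derive_mul (is_derive_mul dX dX) (dL k.+2)))))).
rewrite /laplace_chain exprS (_ : p + k.+1%:R = q + 1); last by rewrite /q -natr1 addrA.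
ring.
Qed.

Let integrable_scale c k x :
  mu.-integrable A (EFin \o (fun t => c * (u t ^+ k * expR (- (x * u t))))).
Proof.
by have := integrableZl mA c (laplace_moment_integrable k x); exact: eq_integrable.
Qed.

Let integrable_linear c1 c2 x : mu.-integrable A (EFin \o (fun t =>
  c1 * (u t ^+ 1 * expR (- (x * u t))) + c2 * (u t ^+ 2 * expR (- (x * u t))))).
Proof.
have := integrableD mA (integrable_scale c1 1 x) (integrable_scale c2 2 x).
exact: eq_integrable.
Qed.

Lemma laplace_chain_integrable p x : mu.-integrable A
  (EFin \o (fun t => expR (- (x * u t)) * ((x * u t - p) ^+ 2 - p))).
Proof.
have := integrableD mA (integrable_scale (p * (p - 1)) 0 x)
  (integrable_linear (- (2 * p * x)) (x ^+ 2) x).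
by apply: eq_integrable => // t _ /=; rewrite -EFinD; congr _%:E; ring.
Qed.

(** Completing the square: [p (p - 1) - 2 p v + v^2 = (v - p)^2 - p] with [v = x u]. *)
Lemma laplace_chain0 p x : laplace_chain p 0 x =
  \int[mu]_(t in A) (expR (- (x * u t)) * ((x * u t - p) ^+ 2 - p)).
Proof.
rewrite /laplace_chain expr0 mul1r addr0.
transitivity (p * (p - 1) * L 0 x + ((- (2 * p * x)) * L 1 x + x ^+ 2 * L 2 x)).
  ring.
rewrite -!RintegralZl//; try exact: laplace_moment_integrable.
rewrite -RintegralD; [|exact: mA|exact: integrable_scale|exact: integrable_scale].
rewrite -RintegralD; [|exact: mA|exact: integrable_scale|exact: integrable_linear].
apply: eq_Rintegral => t _; ring.
Qed.

(* As L_(k+1) <= B L_k, the term quadratic in k dominates for large k. *)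
Lemma laplace_chain_neq0 p x : (forall k, 0 < L k x) ->
  exists k, laplace_chain p k x != 0.
Proof.
move=> L0.
(* The first bound gives [q > 1], the second makes [q - 1] exceed [2 |x| |B|], where [q = p + k]. *)
have [k hk] : exists k : nat, Num.max (- p + 1) (- p + 1 + 2 * `|x| * `|B|) < k%:R.
  by exists (Num.truncn (Num.max (- p + 1) (- p + 1 + 2 * `|x| * `|B|))).+1; exact: truncnS_gt.
move: hk; rewrite gt_max => /andP[k1 k2].
exists k; rewrite /laplace_chain mulf_neq0 ?signr_eq0//; set q := p + k%:R.
have q1 : 1 < q by rewrite /q; lra.
have LB : x * L k.+1 x <= `|x| * `|B| * L k x.
  apply: (le_trans (ler_norm _)); rewrite normrM (gtr0_norm (L0 _)) -mulrA ler_wpM2l//.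
  by apply: le_trans (laplace_moment_leS _ _) _; rewrite ler_wpM2r ?ler_norm// ltW.
have xx : 0 <= x ^+ 2 * L k.+2 x by rewrite mulr_ge0 ?sqr_ge0// ltW.
apply: lt0r_neq0; apply: (@lt_le_trans _ _ (q * (q - 1 - 2 * `|x| * `|B|) * L k x)).
  by rewrite !mulr_gt0//; rewrite /q; lra.
have : 2 * q * (x * L k.+1 x) <= 2 * q * (`|x| * `|B| * L k x) by rewrite ler_wpM2l//; lra.
by lra.
Qed.

End laplace_moments.
End measure_lemmas.

(** * Lebesgue measure on tuples *)

Section lebesgue_tuple_lemmas.
Variable R : realType.

Lemma measurable_forall d (T : measurableType d) (I : finType) (P : I -> set T) :
  (forall i, measurable (P i)) -> measurable [set t | forall i, P i t].
Proof.
move=> mP; rewrite (_ : [set t | _] = \bigcap_(i in setT) P i).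
  by apply: fin_bigcap_measurable => // i _; exact: mP.
by apply/seteqP; split=> t Pt i //; exact: Pt.
Qed.

Definition tuple_box n (c : 'I_n -> R) (e : R) : set (n.-tuple R) :=
  [set t | forall i, `|tnth t i - c i| <= e].

Lemma measurable_tuple_box n (c : 'I_n -> R) e : measurable (tuple_box c e).
Proof.
apply: measurable_forall => i; rewrite -[X in measurable X]setTI.
apply: measurable_fun_le => //; apply: measurableT_comp => //.
by apply: measurable_funB => //; exact: measurable_tnth.
Qed.

(** Induction on [n], splitting off the first coordinate. Boxes serve to bound the measure of a
    region from above and to show that it is positive. *)
Lemma lebesgue_tuple_box n (c : 'I_n -> R) e : 0 <= e ->
  lebesgue_tuple R n (tuple_box c e) = ((2 * e) ^+ n)%:E.
Proof.
move=> e0; elim: n c => [|n IH] c.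
  by rewrite expr0 /= diracE mem_set// => -[].
rewrite [LHS]/= /lebesgue_cons /pushforward.
rewrite (_ : _ @^-1` _ = `[c ord0 - e, c ord0 + e]%classic
    `*` tuple_box (c \o lift ord0) e); last first.
  apply/seteqP; split=> -[x t] /=.
    move=> bxt; split=> /=.
      by have := bxt ord0; rewrite tnth0 in_itv/= ler_norml; lra.
    by move=> i; have := bxt (lift ord0 i); rewrite tnthS.
  rewrite in_itv/= => -[cx bt] i; case: (unliftP ord0 i) => [j ->|->].
    by rewrite tnthS; exact: bt.
  rewrite tnth0/= ler_norml; lra.
rewrite product_measure1E//; last exact: measurable_tuple_box.
rewrite exprS EFinM; congr (_ * _)%E; last exact: IH.
transitivity (lebesgue_measure `[c ord0 - e, c ord0 + e]%classic) => //.
rewrite lebesgue_measure_itv/= lte_fin; case: ltP => ce; last first.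
  by congr _%:E; lra.
by rewrite -EFinB; congr _%:E; ring.
Qed.

(** The integrand is a multiple of the normal density of variance [1 / (2 g)]. *)
Lemma integrable_gauss (g : R) : 0 < g ->
  (\int[lebesgue_measure]_x (expR (- (g * x ^+ 2)))%:E < +oo)%E.
Proof.
move=> g0; set s := Num.sqrt (2 * g)^-1.
have s2 : s ^+ 2 *+ 2 = g^-1.
  rewrite sqr_sqrtr ?invr_ge0 ?mulr_ge0 ?ltW// invfM -mulr_natl.
  by rewrite mulrA divff ?mul1r.
have s0 : s != 0 by rewrite gt_eqF// sqrtr_gt0 invr_gt0 mulr_gt0.
have /(integrableZl measurableT (normal_peak s)^-1) := integrable_normal_pdf 0 s.
move/integrableP => [_]; apply: le_lt_trans.
rewrite le_eqVlt; apply/orP; left; apply/eqP; apply: eq_integral => x _.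
rewrite /= normal_pdfE//= mulKf ?gt_eqF ?normal_peak_gt0//.
rewrite /= ger0_norm ?normal_fun_ge0// /normal_fun s2 subr0 invrK.
by rewrite mulNr mulrC.
Qed.

Lemma measurable_sum_sqr n :
  measurable_fun setT (fun t : n.-tuple R => \sum_i tnth t i ^+ 2).
Proof.
apply: measurable_sum => i; apply: measurable_funX; exact: measurable_tnth.
Qed.

(** The exponential of the sum factors, so Tonelli reduces dimension [n + 1] to dimension [n] and
    one Gaussian integral on the line. *)
Lemma integrable_gauss_tuple n (g : R) : 0 < g ->
  (\int[lebesgue_tuple R n]_t (expR (- (g * \sum_i tnth t i ^+ 2)))%:E < +oo)%E.
Proof.
move=> g0; elim: n => [|n IH].
  rewrite /= integral_dirac//.
    by rewrite diracE mem_set// mul1e ltry.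
  apply/measurable_EFinP; apply: measurableT_comp => //.
  by apply: measurableT_comp => //; apply: measurable_funM => //; exact: measurable_sum_sqr.
have mE k : measurable_fun setT
    (fun t : k.-tuple R => (expR (- (g * \sum_i tnth t i ^+ 2)))%:E).
  apply/measurable_EFinP; apply: measurableT_comp => //.
  by apply: measurableT_comp => //; apply: measurable_funM => //; exact: measurable_sum_sqr.
rewrite [lebesgue_tuple R n.+1]/=.
rewrite (ge0_integral_pushforward (@measurable_tcons R n) _ measurableT (mE _));
  last by move=> t _; rewrite lee_fin expR_ge0.
rewrite preimage_setT fubini_tonelli1; last 2 first.
- exact: (measurableT_comp (mE n.+1) (@measurable_tcons R n)).
- by move=> t /=; rewrite lee_fin expR_ge0.
set I := (\int[_]_t _)%E in IH.
rewrite (_ : (\int[_]_x _)%E =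
    (\int[lebesgue_measure]_x ((expR (- (g * x ^+ 2)))%:E * I))%E); last first.
  apply: eq_integral => x _; rewrite /fubini_F /I -ge0_integralZl_EFin ?expR_ge0//.
    apply: eq_integral => t _; rewrite /= -EFinM -expRD big_ord_recl tnth0.
    rewrite (eq_bigr (fun i => tnth t i ^+ 2)); last by move=> i _; rewrite /tcons/= tnthS.
    by rewrite /= mulrDr opprD.
  exact: mE.
have I0 : (0 <= I)%E by apply: integral_ge0 => t _; rewrite lee_fin expR_ge0.
have J0 : (0 <= \int[@lebesgue_measure R]_x (expR (- (g * x ^+ 2)))%:E)%E.
  by apply: integral_ge0 => x _; rewrite lee_fin expR_ge0.
rewrite ge0_integralZr//; last by apply/measurable_EFinP; apply: measurableT_comp => //;
  apply: measurableT_comp => //; apply: measurable_funM => //; exact: measurable_funX.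
by rewrite lte_mul_pinfty// ?ge0_fin_numE ?integrable_gauss.
Qed.

End lebesgue_tuple_lemmas.

(** * Convexity *)

Section convexity.
Local Open Scope convex_scope.
Variable R : realType.
Implicit Type D : set R.

(** The second derivative test is applied on each segment with ends in [D]; exchanging the ends
    reduces to [a <= b]. *)
Lemma convex_function_second_derivative D (f f1 f2 : R -> R) :
  is_interval D ->
  (forall x : R, D x -> is_derive x 1 f (f1 x)) ->
  (forall x : R, D x -> is_derive x 1 f1 (f2 x)) ->
  (forall x, D x -> 0 <= f2 x) ->
  convex_function (E := R^o) D f.
Proof.
move=> iD df df1 f2_ge0.
have cf (x : R) : D x -> {for x, continuous f}.
  by move=> Dx; have := df x Dx => ?; apply/differentiable_continuous/derivable1_diffP.
have main (a b : R) (t : {i01 R}) : D a -> D b -> a <= b ->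
    f ((a : R^o) <| t |> b) <= (f a : R^o) <| t |> (f b : R^o).
  move=> Da Db ab.
  have Dab x : x \in `]a, b[ -> D x.
    by rewrite in_itv/= => /andP[ax xb]; apply: (iD a b); rewrite // !ltW.
  (* [f1] is the derivative only on [D], so it replaces ['D_1 f] locally, inside the open
     segment. *)
  have nf1 x : x \in `]a, b[ -> {near x, 'D_1 f =1 f1}.
    move=> xab; near=> y; have /Dab/df : y \in `]a, b[ by near: y; exact: near_in_itvoo.
    by move=> ?; exact: derive_val.
  apply: second_derivative_convex => //.
  - move=> x xab; have {}xab : x \in `]a, b[ by rewrite in_itv.
    rewrite (near_eq_derive _ (nf1 x xab)).
    by have := df1 x (Dab x xab) => ?; rewrite derive_val f2_ge0//; exact: Dab.
  - exact/cvg_at_left_filter/cf.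
  - exact/cvg_at_right_filter/cf.
  - by move=> x xab; have := df x (Dab x xab) => ?; exact: ex_derive.
  - move=> x xab; apply: (near_eq_derivable (f := f1)).
      by have /nf1 := xab; apply: filterS => y ->.
    by have := df1 x (Dab x xab) => ?; exact: ex_derive.
move=> t a b /set_mem Da /set_mem Db.
have [ab|/ltW ba] := leP (a : R) b; first exact: main.
by rewrite convC [leRHS]convC; exact: main.
Unshelve. all: by end_near. Qed.

Lemma convex_function_Rintegral d (T : measurableType d)
    (mu : {measure set T -> \bar R}) (A : set T) D (f : R -> T -> R) :
  measurable A -> (forall x, D x -> 0 < x) ->
  (forall x, 0 < x -> mu.-integrable A (EFin \o f x)) ->
  (forall t, A t -> convex_function (E := R^o) D (f ^~ t)) ->
  convex_function (E := R^o) D (fun x => \int[mu]_(t in A) f x t).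
Proof.
move=> mA D0 intf cf t a b Da Db.
have a0 : 0 < a by apply/D0/set_mem.
have b0 : 0 < b by apply/D0/set_mem.
have ia := intf _ a0; have ib := intf _ b0.
have iZ (c x : R) : 0 < x -> mu.-integrable A (EFin \o (fun t => c * f x t)).
  by move=> x0; have := integrableZl mA c (intf _ x0); exact: eq_integrable.
rewrite convRE -!RintegralZl// -RintegralD//; [|exact: iZ|exact: iZ].
apply: le_Rintegral => //.
- by apply: intf; exact: convR_gt0.
- by have := integrableD mA (iZ t%:inum _ a0) (iZ (unstable.onem t%:inum) _ b0); exact: eq_integrable.
- by move=> y Ay; have := cf y Ay t a b Da Db; rewrite convRE.
Qed.

(** The constant [c] may be negative, so that concavity is covered by the same statement. *)
Lemma convex_function_powR_expN (p u c : R) D : is_interval D ->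
  (forall x, D x -> 0 < x) ->
  (forall x, D x -> 0 <= c * ((x * u - p) ^+ 2 - p)) ->
  convex_function (E := R^o) D (fun x => c * (x `^ p * expR (- (x * u)))).
Proof.
move=> iD D0 Dc.
pose L k x : R := u ^+ k * expR (- (x * u)).
have dL k (x : R) : is_derive x 1 (L k) (- L k.+1 x).
  by apply: (is_derive_eq (is_derive_scale (u ^+ k) (is_derive_expN u x))); rewrite /L exprS; ring.
have -> : (fun x => c * (x `^ p * expR (- (x * u)))) = (fun x => c * (x `^ p * L 0 x)).
  by apply/funext => x; rewrite /L expr0 mul1r.
apply: (@convex_function_second_derivative _ _
  (fun x => c * (x `^ (p - 1) * (p * L 0 x - x * L 1 x)))
  (fun x => c * (x `^ (p - 2) * (p * (p - 1) * L 0 x - 2 * p * x * L 1 x + x ^+ 2 * L 2 x)))) => //.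
- by move=> x /D0 x0; apply: is_derive_scale; exact: derive_powR_mul.
- by move=> x /D0 x0; apply: is_derive_scale; exact: derive2_powR_mul.
- move=> x Dx; rewrite (_ : _ * (_ * _) =
    x `^ (p - 2) * expR (- (x * u)) * (c * ((x * u - p) ^+ 2 - p))).
    by rewrite mulr_ge0 ?Dc// mulr_ge0 ?expR_ge0 ?powR_ge0.
  by rewrite /L; ring.
Qed.

End convexity.

(** * Voronoi regions *)

Section euclidean_norm.
Variables (R : realType) (n : nat).
Implicit Types x y : 'rV[R]_n.

Lemma enorm_sqr x : enorm x ^+ 2 = \sum_i x 0 i ^+ 2.
Proof. by rewrite sqr_sqrtr// sumr_ge0// => i _; rewrite sqr_ge0. Qed.

Lemma enorm_ge0 x : 0 <= enorm x. Proof. exact: sqrtr_ge0. Qed.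

Lemma enormZ a x : enorm (a *: x) = `|a| * enorm x.
Proof.
rewrite -sqrtr_sqr -sqrtrM ?sqr_ge0//; congr Num.sqrt.
by rewrite mulr_sumr; apply: eq_bigr => i _; rewrite mxE exprMn.
Qed.

Lemma enormN x : enorm (- x) = enorm x.
Proof. by rewrite -scaleN1r enormZ normrN1 mul1r. Qed.

Lemma enormB x y : enorm (x - y) = enorm (y - x).
Proof. by rewrite -enormN opprB. Qed.

Lemma enorm0 : enorm (0 : 'rV[R]_n) = 0.
Proof. by rewrite -(scale0r 0) enormZ normr0 mul0r. Qed.

Lemma enorm_gt0 x : (0 < enorm x) = (x != 0).
Proof.
rewrite sqrtr_gt0 lt_neqAle sumr_ge0 ?andbT => [|i _]; last exact: sqr_ge0.
rewrite eq_sym psumr_neq0 => [|i _]; last exact: sqr_ge0.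
apply/hasP/idP => [[i _ /= xi]|x0].
  by apply: contraTneq xi => ->; rewrite mxE expr0n ltxx.
have [i xi] : exists i, x 0 i != 0.
  apply/existsP; rewrite -negb_forall; apply: contra x0 => /forallP x0.
  by apply/eqP/rowP => i; rewrite mxE; apply/eqP.
by exists i; rewrite ?mem_index_enum//= exprn_even_gt0.
Qed.

(** Cauchy-Schwarz: with [S] the inner product, the squared norm of [|y|^2 x - S y] equals
    [|y|^2 (|x|^2 |y|^2 - S^2)]. *)
Lemma enorm_dot x y : (\sum_i x 0 i * y 0 i) <= enorm x * enorm y.
Proof.
have [->|y0] := eqVneq y 0.
  by rewrite enorm0 mulr0 big1// => i _; rewrite mxE mulr0.
set S := \sum_i _.
have Y0 : 0 < enorm y ^+ 2 by rewrite exprn_gt0// enorm_gt0.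
have : 0 <= \sum_i (enorm y ^+ 2 * x 0 i - S * y 0 i) ^+ 2.
  by apply: sumr_ge0 => i _; rewrite sqr_ge0.
rewrite (_ : \sum_i _ = enorm y ^+ 2 * (enorm x ^+ 2 * enorm y ^+ 2 - S ^+ 2)).
  rewrite pmulr_rge0// subr_ge0 -exprMn => SXY.
  apply: (le_trans (ler_norm _)).
  by rewrite -[leRHS]ger0_norm ?mulr_ge0 ?enorm_ge0// -ler_sqr ?nnegrE// !real_normK ?num_real.
rewrite (eq_bigr (fun i => enorm y ^+ 4 * x 0 i ^+ 2 - 2 * enorm y ^+ 2 * S * (x 0 i * y 0 i)
  + S ^+ 2 * y 0 i ^+ 2)); last by move=> i _; ring.
rewrite big_split/= sumrB -!mulr_sumr -!enorm_sqr -/S; ring.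
Qed.

Lemma ler_enormD x y : enorm (x + y) <= enorm x + enorm y.
Proof.
rewrite -ler_sqr ?nnegrE ?addr_ge0 ?enorm_ge0// enorm_sqr sqrrD !enorm_sqr.
rewrite (eq_bigr (fun i => x 0 i ^+ 2 + 2 * (x 0 i * y 0 i) + y 0 i ^+ 2)).
  rewrite !big_split/= -mulr_sumr lerD2r lerD2l mulr2n.
  by have := enorm_dot x y; lra.
by move=> i _; rewrite mxE; ring.
Qed.

Lemma enorm_continuous : continuous (@enorm R n).
Proof.
move=> x; apply: (@continuous_comp _ _ _ (fun x : 'rV[R]_n => \sum_i x 0 i ^+ 2) Num.sqrt).
  apply: cvg_big; [exact: add_continuous|exact: (@nbhs_filter 'rV[R]_n x)|move=> i _].
  apply: (@continuous_comp _ _ _ (fun x : 'rV[R]_n => x 0 i) (fun r => r ^+ 2)).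
    exact: coord_continuous.
  exact: exprn_continuous.
exact: sqrt_continuous.
Qed.

Lemma enormB_continuous c : continuous (fun y : 'rV[R]_n => enorm (y - c)).
Proof.
move=> y; apply: (@continuous_comp _ _ _ (fun y : 'rV[R]_n => y - c)); last exact: enorm_continuous.
apply: (@continuousB _ _ _ id (fun=> c) y); [by move=> ?; exact|exact: cst_continuous].
Qed.

Lemma open_eball c e : open [set y : 'rV[R]_n | enorm (y - c) < e].
Proof.
rewrite (_ : [set _ | _] = (fun y => enorm (y - c)) @^-1` `]-oo, e[%classic).
  by apply: open_comp => [y _|]; [exact: enormB_continuous|exact: interval_open].
by apply/seteqP; split=> y /=; rewrite in_itv.
Qed.

End euclidean_norm.

(** * Segments crossing the boundary of a set *)

Section boundary_lemmas.
Variables (R : realType) (n : nat).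

(** Otherwise the closure and the interior of [A] have the same trace on the segment. This trace is
    open, closed and contains [p], hence by connectedness it contains [q]. *)
Lemma segment_meets_boundary (A : set 'rV[R]_n) (p q : 'rV[R]_n) :
  A p -> ~ A° q -> exists2 t : R, 0 <= t <= 1 & boundary A (p + t *: (q - p)).
Proof.
move=> Ap Aq; apply: contrapT => noB.
pose phi (t : R) := p + t *: (q - p).
have cphi : continuous phi.
  by move=> t; apply: cvgD; [exact: cvg_cst|exact: scalel_continuous].
have inA t : 0 <= t <= 1 -> closure A (phi t) -> A° (phi t).
  by move=> t01 cA; apply: contrapT => iA; apply: noB; exists t.
suff E : `[0, 1]%classic `&` phi @^-1` A° = `[0, 1]%classic.
  apply: Aq; rewrite (_ : q = phi 1); last by rewrite /phi scale1r subrKC.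
  have : `[0, 1]%classic (1 : R) by rewrite /= in_itv/= ler01 lexx.
  by rewrite -E => -[].
apply: segment_connected.
- exists 0; split; first by rewrite /= in_itv/= lexx ler01.
  apply: inA; first by rewrite lexx ler01.
  by rewrite /phi scale0r addr0; exact: subset_closure.
- exists (phi @^-1` A°) => //; apply: open_comp => [t _|]; first exact: cphi.
  exact: open_interior.
- exists (phi @^-1` closure A).
    by apply: closed_comp => [t _|]; [exact: cphi|exact: closed_closure].
  apply/seteqP; split=> t [t01 At]; split=> //.
    by apply: subset_closure; exact: interior_subset At.
  by apply: inA => //; move: t01; rewrite /= in_itv.
Qed.

Lemma convex_segment_dist (c x : 'rV[R]_n) (t : R) : 0 <= t <= 1 ->
  enorm (c + t *: (x - c) - c) <= enorm (x - c).
Proof.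
move=> /andP[t0 t1]; rewrite addrAC subrr add0r enormZ ger0_norm//.
by rewrite ler_piMl// enorm_ge0.
Qed.

End boundary_lemmas.

(** * Geometry of the decision regions *)

Section voronoi_lemmas.
Variables (R : realType) (n M : nat) (s : 'I_M -> 'rV[R]_n).
Hypothesis s_inj : injective s.
Implicit Types i j k l : 'I_M.

Lemma dist_gt0 k l : k != l -> 0 < enorm (s k - s l).
Proof. by move=> kl; rewrite enorm_gt0 subr_eq0; apply: contra_neq kl => /s_inj. Qed.

(** The radius is at most half the distance to each other point, and the triangle inequality
    concludes. *)
Lemma voronoi_ball k : exists2 d, 0 < d & forall y, enorm (y - s k) < d -> voronoi s k y.
Proof.
have [d /= d0 Hd] : exists2 d, 0 < d & forall l, l != k -> 2 * d <= enorm (s k - s l).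
  have : \forall d \near 0^'+, forall l, l != k -> 2 * d <= enorm (s k - s l).
    apply: filter_forall => l; have [->|lk] := eqVneq l k; first exact: nearW.
    have := dist_gt0 lk; rewrite enormB => kl0.
    near=> d => _; rewrite -ler_pdivlMl//; near: d; apply: nbhs_right_le.
    by rewrite mulr_gt0// invr_gt0.
  move=> Hd; have Hd0 : \forall d \near (0 : R)^'+, 0 < d by exact: nbhs_right_gt.
  by have [d [? ?]] := @filter_ex _ _ _ _ (filterI Hd0 Hd); exists d.
exists d => // y yd l; have [->//|lk] := eqVneq l k.
have := ler_enormD (s k - y) (y - s l); rewrite addrA subrK (enormB (s k)).
by have := Hd l lk; lra.
Unshelve. all: by end_near. Qed.

Lemma voronoi_center k : voronoi s k (s k).
Proof. by move=> l; rewrite subrr enorm0 enorm_ge0. Qed.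

Lemma closed_voronoi k : closed (voronoi s k).
Proof.
rewrite (_ : voronoi s k = \bigcap_(l in setT)
    (fun y => enorm (y - s l) - enorm (y - s k)) @^-1` `[0, +oo[%classic).
  apply: closed_bigI => l _; apply: closed_comp => [y _|]; last exact: interval_closed.
  exact: (continuousB (@enormB_continuous _ _ (s l) y) (@enormB_continuous _ _ (s k) y)).
apply/seteqP; split=> y Hy l; first by move=> _; rewrite /= in_itv/= andbT subr_ge0.
by have := Hy l I; rewrite /= in_itv/= andbT subr_ge0.
Qed.

Lemma boundary_voronoi_sub k : boundary (voronoi s k) `<=` voronoi s k.
Proof.
move=> y [cy _]; have := @closed_voronoi k.
by rewrite closure_id => ->.
Qed.

Lemma boundary_dist_ge0 k r : boundary_dist s k r -> 0 <= r.
Proof. by move=> [y _ <-]; exact: enorm_ge0. Qed.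

(* Moving from y in the direction s_j - s_i strictly favours s_j over s_i. *)
Lemma not_interior_voronoi i j y : i != j ->
  enorm (y - s j) <= enorm (y - s i) -> ~ (voronoi s i)° y.
Proof.
move=> ij yij Vy; pose w := s j - s i.
have w0 : 0 < enorm w by rewrite dist_gt0// eq_sym.
have cw : (fun t : R => y + t *: w) @ 0^'+ --> y + 0 *: w.
  apply: cvg_at_right_filter.
  by apply: cvgD; [exact: cvg_cst|exact: scalel_continuous].
rewrite scale0r addr0 in cw; have {cw Vy} /cw Vt := Vy.
have Hd0 : \forall d \near (0 : R)^'+, 0 < d by exact: nbhs_right_gt.
have [t [t0 /(_ j)]] := @filter_ex _ _ _ _ (filterI Hd0 Vt).
apply/negP; rewrite -ltNge -ltr_sqr ?nnegrE ?enorm_ge0//.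
have : enorm (y - s j) ^+ 2 <= enorm (y - s i) ^+ 2.
  by rewrite ler_sqr ?nnegrE ?enorm_ge0.
have : 0 < 2 * t * enorm w ^+ 2 by rewrite !mulr_gt0// exprn_gt0.
suff -> : enorm (y + t *: w - s i) ^+ 2 = enorm (y + t *: w - s j) ^+ 2 +
  (enorm (y - s i) ^+ 2 - enorm (y - s j) ^+ 2 + 2 * t * enorm w ^+ 2) by lra.
rewrite !enorm_sqr mulr_sumr -sumrB -!big_split/=; apply: eq_bigr => k _.
by rewrite !mxE; ring.
Qed.

(** The segment from [s i] to [y] ends outside the interior of the region, so it crosses the
    boundary no farther than [y]. *)
Lemma boundary_voronoi_le i j y : i != j -> enorm (y - s j) <= enorm (y - s i) ->
  exists2 r, boundary_dist s i r & r <= enorm (y - s i).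
Proof.
move=> ij yij.
have [t t01 Bz] := segment_meets_boundary (@voronoi_center i) (not_interior_voronoi ij yij).
by eexists; [exists (s i + t *: (y - s i)) => //|exact: convex_segment_dist].
Qed.

Lemma dmin_le i j y : i != j -> enorm (y - s j) <= enorm (y - s i) ->
  dmin s i <= enorm (y - s i).
Proof.
move=> ij /(boundary_voronoi_le ij)[r Br]; apply: le_trans.
by apply: ge_inf => //; exists 0 => ? /boundary_dist_ge0.
Qed.

(** A ball around [s i] lies in the interior of its region, so boundary points stay away. The
    infimum is over a nonempty set, as the segment to [s j] meets the boundary. *)
Lemma dmin_gt0 i j : i != j -> 0 < dmin s i.
Proof.
move=> ij; have [d d0 Hd] := voronoi_ball i.
apply: (lt_le_trans d0); apply: lb_le_inf.
  have [|r Br _] := @boundary_voronoi_le i j (s j) ij; last by exists r.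
  by rewrite subrr enorm0 enorm_ge0.
move=> _ [y [_ iy] <-]; rewrite leNgt; apply/negP => yd; apply: iy.
have : [set y | enorm (y - s i) < d] `<=` (voronoi s i)°.
  by rewrite -open_subsetE; [exact: Hd|exact: open_eball].
exact.
Qed.

(** The midpoint of [s i] and [s j] gives the bound [d_ij / 2]. The strict inequality yields a
    strict sign at the upper end of the SNR range. *)
Lemma dmin_lt_dist i j : i != j -> dmin s i < enorm (s i - s j).
Proof.
move=> ij; have d0 := dist_gt0 ij.
have E : enorm (2^-1 *: (s i + s j) - s i) = 2^-1 * enorm (s i - s j).
  rewrite enormB -[2^-1 in RHS]gtr0_norm// -enormZ; congr enorm.
  by apply/rowP => k; rewrite !mxE; field.
have /(dmin_le ij) : enorm (2^-1 *: (s i + s j) - s j) <= enorm (2^-1 *: (s i + s j) - s i).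
  rewrite E -[2^-1 in leRHS]gtr0_norm// -enormZ le_eqVlt; apply/orP; left.
  by apply/eqP; congr enorm; apply/rowP => k; rewrite !mxE; field.
by rewrite E; lra.
Qed.

Section bounded_region.
Variable j : 'I_M.
Hypothesis bV : bounded_set (voronoi s j).

Lemma voronoi_coord_bound : exists2 N, 0 < N & forall y (k : 'I_n), voronoi s j y -> `|y 0 k| <= N.
Proof.
have [N N0 VN] := ex_strict_bound_gt0 bV.
exists N => // y k /VN /= /ltW; apply: le_trans.
rewrite [leRHS]/Num.norm/= mx_normrE; apply/bigmax_geP; right.
by exists (0, k).
Qed.

Lemma boundary_dist_has_ubound : has_ubound (boundary_dist s j).
Proof.
have [N N0 VN] := voronoi_coord_bound.
(* A square root is avoided by [r <= 1 + r^2], valid for nonnegative [r]. *)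
exists (1 + n%:R * N ^+ 2 + enorm (s j)) => _ [y /boundary_voronoi_sub Vy <-].
apply: (le_trans (ler_enormD _ _)); rewrite enormN lerD2r.
have : enorm y ^+ 2 <= n%:R * N ^+ 2.
  rewrite enorm_sqr mulr_natl -[n in leRHS]card_ord -sumr_const.
  by apply: ler_sum => k _; rewrite -real_normK ?num_real// lerXn2r ?nnegrE ?(ltW N0)// VN.
have : 0 <= (enorm y - 1) ^+ 2 by exact: sqr_ge0.
have := enorm_ge0 y; rewrite sqrrB; lra.
Qed.

(** The ray from [s j] through [y] leaves the bounded region, and beyond [y] it meets the boundary
    at a point at least as far from [s j]. *)
Lemma dmax_ge y : voronoi s j y -> enorm (y - s j) <= dmax s j.
Proof.
move=> Vy; have [->|yj] := eqVneq y (s j).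
  (* There is no ray when [y = s j]; if moreover the boundary is empty, [sup] takes its default
     value 0. *)
  rewrite subrr enorm0 /dmax; have [->|/set0P[r Br]] := eqVneq (boundary_dist s j) set0.
    by rewrite sup0.
  by apply: (le_trans (boundary_dist_ge0 Br)); exact: (ub_le_sup boundary_dist_has_ubound).
have [k vk] : exists k : 'I_n, (y - s j) 0 k != 0.
  apply/existsP; rewrite -negb_forall; apply: contra yj => /forallP v0.
  by rewrite -subr_eq0; apply/eqP/rowP => k; rewrite [RHS]mxE; apply/eqP.
have [N N0 VN] := voronoi_coord_bound.
(* This factor makes coordinate [k] of [q] exceed [N] in absolute value. *)
pose T := 1 + (N + `|s j 0 k|) / `|(y - s j) 0 k|.
have T1 : 1 <= T by rewrite lerDl divr_ge0// addr_ge0// ltW.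
pose q := s j + T *: (y - s j).
have Vq : ~ (voronoi s j)° q.
  move=> /(@interior_subset _ (voronoi s j) q)/(VN _ k).
  have := ler_normB (q 0 k) (s j 0 k).
  have -> : q 0 k - s j 0 k = T * (y - s j) 0 k by rewrite !mxE; ring.
  have v0 : 0 < `|(y - s j) 0 k| by rewrite normr_gt0.
  rewrite normrM ger0_norm ?(le_trans ler01)// /T mulrDl divfK ?lt0r_neq0//.
  by move: v0; rewrite !mxE; lra.
have [t /andP[t0 t1] Bz] := segment_meets_boundary Vy Vq.
have /le_trans -> // : enorm (y - s j) <= enorm (y + t *: (q - y) - s j).
  have -> : y + t *: (q - y) - s j = (1 + t * (T - 1)) *: (y - s j).
    by apply/rowP => l; rewrite !mxE; ring.
  rewrite enormZ ler_peMl ?enorm_ge0// (le_trans _ (ler_norm _))// lerDl.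
  by rewrite mulr_ge0// subr_ge0.
by apply: ub_le_sup; [exact: boundary_dist_has_ubound|exists (y + t *: (q - y))].
Qed.

Lemma dmax_gt0 i : i != j -> 0 < dmax s j.
Proof.
move=> ij; have [d d0 Hd] := voronoi_ball j.
have D0 := dist_gt0 ij.
pose t := d / (2 * enorm (s i - s j)).
have t0 : 0 < t by rewrite divr_gt0// mulr_gt0.
have E : enorm (s j + t *: (s i - s j) - s j) = d / 2.
  rewrite addrAC subrr add0r enormZ gtr0_norm// /t; field; exact: lt0r_neq0.
have /dmax_ge : voronoi s j (s j + t *: (s i - s j)) by apply: Hd; rewrite E; lra.
by rewrite E; lra.
Qed.

End bounded_region.
End voronoi_lemmas.

(** * The pairwise error probability *)

Section second_derivative.
Variables (R : realType) (p c : R) (f L0 L1 L2 : R -> R).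
Hypothesis fE : forall x, 0 < x -> f x = c * (x `^ p * L0 x).
Hypothesis dL0 : forall x : R, is_derive x 1 L0 (- L1 x).
Hypothesis dL1 : forall x : R, is_derive x 1 L1 (- L2 x).

(** The formula for [f] is known only at positive arguments, so each differentiation uses equality
    near [x]. *)
Lemma derive1n2_powR_mul x : 0 < x -> derive1n 2 f x =
  c * (x `^ (p - 2) * (p * (p - 1) * L0 x - 2 * p * x * L1 x + x ^+ 2 * L2 x)).
Proof.
move=> x0; have df (y : R) : 0 < y -> derive1 f y = c * (y `^ (p - 1) * (p * L0 y - y * L1 y)).
  move=> y0; rewrite derive1E (near_eq_derive (g := fun y => c * (y `^ p * L0 y))).
    by apply: derive_val; apply: is_derive_scale; exact: derive_powR_mul.
  by near=> z; apply: fE; near: z; exact: lt_nbhsr.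
rewrite derive1Sn derive1n1 derive1E (near_eq_derive (g := fun y => c * (y `^ (p - 1) * (p * L0 y - y * L1 y)))).
  by apply: derive_val; apply: is_derive_scale; exact: derive2_powR_mul.
by near=> z; apply: df; near: z; exact: lt_nbhsr.
Unshelve. all: by end_near. Qed.

End second_derivative.

(** * Sign of the quadratic [(v - p)^2 - p], whose roots satisfy [2 v = n - sqrt (2 n)] and
    [2 v = n + sqrt (2 n)] *)

Section low_high_snr.
Variables (R : realType) (n : nat).
Local Notation p := (n%:R / 2 : R).
Local Notation q := (Num.sqrt (2 * n%:R) : R).

Let q2 : q ^+ 2 = 2 * n%:R. Proof. by rewrite sqr_sqrtr// mulr_ge0. Qed.
Let q0 : 0 <= q. Proof. exact: sqrtr_ge0. Qed.

Lemma high_snr_ge0 v : n%:R + q <= 2 * v -> 0 <= (v - p) ^+ 2 - p.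
Proof.
have q_ge0 := q0; move=> h; have : (q / 2) ^+ 2 <= (v - p) ^+ 2 by rewrite lerXn2r ?nnegrE//; lra.
by rewrite expr_div_n q2; lra.
Qed.

Lemma high_snr_gt0 v : n%:R + q < 2 * v -> 0 < (v - p) ^+ 2 - p.
Proof.
have q_ge0 := q0; move=> h; have : (q / 2) ^+ 2 < (v - p) ^+ 2 by rewrite ltrXn2r ?nnegrE//; lra.
by rewrite expr_div_n q2; lra.
Qed.

Lemma low_snr_ge0 v : 2 * v <= n%:R - q -> 0 <= (v - p) ^+ 2 - p.
Proof.
have q_ge0 := q0; move=> h; have : (q / 2) ^+ 2 <= (p - v) ^+ 2 by rewrite lerXn2r ?nnegrE//; lra.
by rewrite expr_div_n q2 (_ : (v - p) ^+ 2 = (p - v) ^+ 2); [lra|ring].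
Qed.

Lemma low_snr_gt0 v : 2 * v < n%:R - q -> 0 < (v - p) ^+ 2 - p.
Proof.
have q_ge0 := q0; move=> h; have : (q / 2) ^+ 2 < (p - v) ^+ 2 by rewrite ltrXn2r ?nnegrE//; lra.
by rewrite expr_div_n q2 (_ : (v - p) ^+ 2 = (p - v) ^+ 2); [lra|ring].
Qed.

Lemma dim_le_sqrt : (n <= 2)%N -> n%:R <= q.
Proof.
move=> n2; rewrite -ler_sqr ?nnegrE// q2 expr2 ler_wpM2r//.
by rewrite ler_nat.
Qed.

Lemma sqrt_lt_dim : (2 < n)%N -> q < n%:R.
Proof.
move=> n2; have n0 : 0 < n%:R :> R by rewrite ltr0n (leq_trans _ n2).
by rewrite -ltr_sqr ?nnegrE ?(ltW n0)// q2 expr2 ltr_pM2r// ltr_nat.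
Qed.

(** In dimensions up to 2 the lower root is not positive, so every [v >= 0] below the upper root
    lies between the two. *)
Lemma low_dim_snr_le0 v : (n <= 2)%N -> 0 <= v -> 2 * v <= n%:R + q ->
  (v - p) ^+ 2 - p <= 0.
Proof.
have q_ge0 := q0; move=> /dim_le_sqrt nq v0 h; have : `|v - p| ^+ 2 <= (q / 2) ^+ 2.
  by rewrite lerXn2r ?nnegrE ?divr_ge0// ler_norml; lra.
by rewrite real_normK ?num_real// expr_div_n q2; lra.
Qed.

Lemma low_dim_snr_lt0 v : (n <= 2)%N -> 0 < v -> 2 * v < n%:R + q ->
  (v - p) ^+ 2 - p < 0.
Proof.
have q_ge0 := q0; move=> /dim_le_sqrt nq v0 h; have : `|v - p| ^+ 2 < (q / 2) ^+ 2.
  by rewrite ltrXn2r ?nnegrE ?divr_ge0// ltr_norml; lra.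
by rewrite real_normK ?num_real// expr_div_n q2; lra.
Qed.

End low_high_snr.

Section pairwise_error_probability.
Variables (R : realType) (n M : nat) (s : 'I_M -> 'rV[R]_n) (i j : 'I_M).
Hypotheses (s_inj : injective s) (ij : i != j).

Local Notation mu := (lebesgue_tuple R n).
Local Notation p := (n%:R / 2 : R).
Local Notation c := ((2 * pi) `^ (- p) : R).
Local Notation P := (pep s i j).

Let A : set (n.-tuple R) := [set t | voronoi s j (s i + row_of_tuple t)].
Let u (t : n.-tuple R) : R := enorm (row_of_tuple t) ^+ 2 / 2.

Let measurable_enorm_row (a : 'rV[R]_n) :
  measurable_fun setT (fun t : n.-tuple R => enorm (a + row_of_tuple t)).
Proof.
have msqrt : measurable_fun setT (@Num.sqrt R).
  by apply: continuous_measurable_fun; exact: sqrt_continuous.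
apply: (measurableT_comp msqrt).
apply: measurable_sum => k; apply: measurable_funX.
rewrite (_ : (fun t => _) = (fun t => a 0 k + tnth t k)); last first.
  by apply/funext => t; rewrite !mxE.
by apply: measurable_funD => //; exact: measurable_tnth.
Qed.

Let mA : measurable A.
Proof.
apply: measurable_forall => l; rewrite -[X in measurable X]setTI.
have E k : (fun t : n.-tuple R => enorm (s i + row_of_tuple t - s k)) =
    (fun t => enorm (s i - s k + row_of_tuple t)).
  by apply/funext => t; rewrite addrAC.
by apply: measurable_fun_le => //; rewrite E; exact: measurable_enorm_row.
Qed.

Let uE t : u t = (\sum_k tnth t k ^+ 2) / 2.
Proof. by rewrite /u enorm_sqr; congr (_ / _); apply: eq_bigr => k _; rewrite mxE. Qed.

Let mu_u D : measurable_fun D u.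
Proof.
apply: (@measurable_funS _ _ _ _ setT) => //.
rewrite (_ : u = fun t => (\sum_k tnth t k ^+ 2) / 2); last exact/funext.
by apply: measurable_funM => //; exact: measurable_sum_sqr.
Qed.

Let c_gt0 : 0 < c. Proof. by rewrite powR_gt0// mulr_gt0 ?pi_gt0. Qed.

Let PE x : 0 < x -> P x = \int[mu]_(t in A) (c * (x `^ p * expR (- (x * u t)))).
Proof.
move=> x0; apply: eq_Rintegral => t _; rewrite /awgn_pdf powRM ?mulr_ge0 ?pi_ge0 ?invr_ge0 ?(ltW x0)//.
rewrite -mulrA; congr (_ * (_ * expR _)).
  by rewrite -powR_inv1 ?(ltW x0)// -powRrM; congr (_ `^ _); ring.
by rewrite /u; congr (- _); field; exact: lt0r_neq0.
Qed.

(** The region may be unbounded: integrability comes from the Gaussian on the whole space, with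
    parameter [x / 2]. *)
Let integrable_pdf x : 0 < x ->
  mu.-integrable A (EFin \o (fun t => c * (x `^ p * expR (- (x * u t))))).
Proof.
move=> x0; have h : mu.-integrable A (EFin \o (fun t => expR (- (x * u t)))).
  apply: (@integrableS _ _ _ _ setT) => //; apply/integrableP; split.
    apply/measurable_EFinP; apply: measurableT_comp => //.
    by apply: measurableT_comp => //; exact: measurable_funM.
  under eq_integral do rewrite /= ger0_norm ?expR_ge0// uE mulrCA mulrC.
  by apply: integrable_gauss_tuple; lra.
by have := integrableZl mA (c * x `^ p) h; apply: eq_integrable => // t _ /=;
  rewrite mulrA.
Qed.

(** Used with [e = 1] for convexity and [e = -1] for concavity. *)
Let convexP e (D : set R) : is_interval D -> (forall x, D x -> 0 < x) ->
  (forall x t, D x -> A t -> 0 <= e * ((x * u t - p) ^+ 2 - p)) ->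
  convex_function (E := R^o) D (fun x => e * P x).
Proof.
move=> iD D0 De.
have cI : convex_function (E := R^o) D (fun x => \int[mu]_(t in A)
   (e * (c * (x `^ p * expR (- (x * u t)))))).
  apply: convex_function_Rintegral => //.
    by move=> x x0; have := integrableZl mA e (integrable_pdf x0); exact: eq_integrable.
  move=> t At.
  rewrite (_ : (fun x => _) = fun x => e * c * (x `^ p * expR (- (x * u t)))); last first.
    by apply/funext => x; rewrite mulrA.
  apply: convex_function_powR_expN => // x Dx.
  by rewrite mulrAC mulr_ge0 ?(ltW c_gt0)// De.
move=> t a b Da Db; have := cI t a b Da Db.
have a0 : 0 < a by apply/D0/set_mem.
have b0 : 0 < b by apply/D0/set_mem.
have ab0 := @convR_gt0 R a b t a0 b0.
have RE x (x0 : 0 < x) : \int[mu]_(t in A) (e * (c * (x `^ p * expR (- (x * u t))))) = e * P x.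
  by rewrite PE// RintegralZl//; exact: integrable_pdf.
by rewrite (RE _ a0) (RE _ b0) (RE _ ab0).
Qed.

(** Noise that carries [s i] into the region of [s j] ends at least as close to [s j] as to [s i],
    so [dmin_le] applies. *)
Let A_dmin t : A t -> dmin s i <= enorm (row_of_tuple t).
Proof.
move=> At; rewrite -[row_of_tuple t](addKr (s i)) addrC.
by apply: (dmin_le s_inj ij); exact: At.
Qed.

Let twice_mul_half (x y : R) : 2 * (x * (y / 2)) = x * y.
Proof. by field. Qed.

Let twice_mul_u x t : 2 * (x * u t) = x * enorm (row_of_tuple t) ^+ 2.
Proof. exact: twice_mul_half. Qed.

Hypothesis n_ge1 : (1 <= n)%N.

Local Notation q := (Num.sqrt (2 * n%:R) : R).
Local Notation hi := ((n%:R + q) / dmin s i ^+ 2).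

Let n_gt0 : 0 < n%:R :> R. Proof. by rewrite ltr0n. Qed.

Let dmin2_gt0 : 0 < dmin s i ^+ 2.
Proof. by rewrite exprn_gt0// (dmin_gt0 s_inj ij). Qed.

Let hi_gt0 : 0 < hi.
Proof. by rewrite divr_gt0// ltr_wpDr ?sqrtr_ge0. Qed.

Lemma pep_convex_high : convex_function (E := R^o) [set x | hi <= x] P.
Proof.
rewrite (_ : P = fun x => 1 * P x); last by apply/funext => x; rewrite mul1r.
apply: convexP.
- by move=> a b /= ha hb x /andP[ax _]; exact: le_trans ax.
- by move=> x; exact: lt_le_trans.
move=> x t /= hx At; rewrite mul1r; apply: high_snr_ge0; rewrite twice_mul_u.
move: (hx); rewrite ler_pdivrMr// => /le_trans; apply.
rewrite ler_wpM2l//; first exact: le_trans (ltW hi_gt0) hx.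
by rewrite lerXn2r ?nnegrE ?enorm_ge0 ?A_dmin// ltW// (dmin_gt0 s_inj ij).
Qed.

(** * Low SNR and inflection points, for a bounded decision region *)

Section bounded_region.
Hypothesis bV : bounded_set (voronoi s j).
Local Notation rho := (enorm (s i - s j) + dmax s j).

Let A_dmax t : A t -> enorm (row_of_tuple t) <= rho.
Proof.
move=> At; rewrite -[row_of_tuple t](addKr (s i)) addrC.
rewrite (_ : _ - s i = (s j - s i) + (s i + row_of_tuple t - s j)); last first.
  by apply/rowP => k; rewrite !mxE; ring.
apply: (le_trans (ler_enormD _ _)); rewrite enormB lerD2l.
exact: dmax_ge At.
Qed.

Let Afin : (mu A < +oo)%E.
Proof.
have [N N0 VN] := voronoi_coord_bound bV.
apply: (@le_lt_trans _ _ (mu (tuple_box (fun k => - s i 0 k) N))); last first.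
  by rewrite lebesgue_tuple_box ?(ltW N0)// ltry.
apply: le_measure; rewrite ?inE//; first exact: measurable_tuple_box.
by move=> t At k; have := VN _ k At; rewrite !mxE opprK addrC.
Qed.

Let u_bound t : A t -> 0 <= u t <= rho ^+ 2 / 2.
Proof.
move=> At; rewrite divr_ge0 ?sqr_ge0// ler_pM2r// lerXn2r ?nnegrE ?enorm_ge0 ?A_dmax//.
exact: le_trans (enorm_ge0 _) (A_dmax At).
Qed.

(** The displacement [s j - s i] is interior to the shifted region, so a small box around it stays
    inside and keeps [phi] positive. Such boxes feed [Rintegral_gt0]. *)
Let region_box (phi : 'rV[R]_n -> R) :
    {for s j - s i, continuous phi} -> 0 < phi (s j - s i) ->
  exists E : set (n.-tuple R), [/\ measurable E, E `<=` A, (0 < mu E)%E &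
    forall t, E t -> 0 < phi (row_of_tuple t)].
Proof.
move=> cphi phi0; have [d d0 Vd] := voronoi_ball s_inj j.
have n1 : \forall y \near s j - s i, 0 < phi y by exact: (cvgr_gt _ cphi).
have n2 : \forall y \near s j - s i, voronoi s j (s i + y).
  have := @open_eball R n (s j - s i) d.
  rewrite openE => /(_ (s j - s i)); rewrite /= subrr enorm0 => /(_ d0).
  apply: filterS => y yd; apply: Vd.
  by rewrite (_ : s i + y - s j = y - (s j - s i))// opprB addrA [y + _]addrC.
have [e /= e0 He] := (nbhs_ballP _ _).1 (filterI n1 n2).
exists (tuple_box (fun k => (s j - s i) 0 k) (e / 2)).
have bE t : tuple_box (fun k => (s j - s i) 0 k) (e / 2) t ->
    ball (s j - s i) e (row_of_tuple t).
  move=> bt; split=> // a k; rewrite ord1 /ball/= distrC [_ (row_of_tuple t) _ _]mxE.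
  by apply: (le_lt_trans (bt k)); lra.
split.
- exact: measurable_tuple_box.
- by move=> t /bE/He[].
- by rewrite lebesgue_tuple_box ?divr_ge0 ?(ltW e0)// lte_fin exprn_gt0//; lra.
- by move=> t /bE/He[].
Qed.

Local Notation L := (laplace_moment mu A u).
Local Notation H := (laplace_chain mu A u p).

Let L_gt0 k x : 0 < L k x.
Proof.
have [E [mE EA E0 _]] := @region_box (fun=> 1) (@cst_continuous _ _ _ _) ltr01.
have f0 t : A t -> 0 < u t ^+ k * expR (- (x * u t)).
  move=> At; rewrite mulr_gt0 ?expR_gt0// exprn_gt0// divr_gt0// exprn_gt0//.
  exact: lt_le_trans (dmin_gt0 s_inj ij) (A_dmin At).
apply: (Rintegral_gt0 mA mE EA E0).
- exact: (laplace_moment_integrable mA Afin (@mu_u A) u_bound).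
- by move=> t /f0/ltW.
- by move=> t /EA/f0.
Qed.

(** A weak sign of the integrand on [A] suffices once it is strict at the displacement [s j - s i]:
    continuity spreads it over a box of positive measure. *)
Let H_has_sign (b : bool) x :
  (forall t, A t -> 0 <= (-1) ^+ b * ((x * u t - p) ^+ 2 - p)) ->
  0 < (-1) ^+ b * ((x * (enorm (s j - s i) ^+ 2 / 2) - p) ^+ 2 - p) ->
  has_sign b (H 0 x).
Proof.
move=> Hge Hgt; rewrite /has_sign (laplace_chain0 mA Afin (@mu_u A) u_bound).
have intH := laplace_chain_integrable mA Afin (@mu_u A) u_bound p x.
rewrite -RintegralZl//.
pose phi (y : 'rV[R]_n) : R := (-1) ^+ b * ((x * (enorm y ^+ 2 / 2) - p) ^+ 2 - p).
have cphi : {for s j - s i, continuous phi}.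
  have cg : continuous (fun r : R => (-1) ^+ b * ((x * (r ^+ 2 / 2) - p) ^+ 2 - p)).
    move=> r; apply: cvgM; first exact: cvg_cst.
    apply: cvgB; last exact: cvg_cst.
    apply: (@continuous_comp _ _ _ (fun r : R => x * (r ^+ 2 / 2) - p) (fun r => r ^+ 2)).
      apply: cvgB; last exact: cvg_cst.
      apply: cvgM; first exact: cvg_cst.
      by apply: cvgM; [exact: exprn_continuous|exact: cvg_cst].
    exact: exprn_continuous.
  exact: (@continuous_comp _ _ _ (@enorm R n) _ _ (@enorm_continuous R n _) (cg _)).
have [E [mE EA E0 Epos]] := region_box cphi Hgt.
apply: (Rintegral_gt0 mA mE EA E0).
- by have := integrableZl mA ((-1) ^+ b) intH; exact: eq_integrable.
- by move=> t At; rewrite mulrCA mulr_ge0 ?expR_ge0// Hge.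
- by move=> t /Epos phit; rewrite mulrCA mulr_gt0 ?expR_gt0.
Qed.

Let derive2P x : 0 < x -> derive1n 2 P x = c * x `^ (p - 2) * H 0 x.
Proof.
have dL k (y : R) := laplace_moment_derive mA Afin (@mu_u A) u_bound k y.
move=> x0; rewrite (@derive1n2_powR_mul R p c P (L 0) (L 1) (L 2))//.
  by rewrite /laplace_chain expr0 mul1r addr0 mulrA.
move=> y y0; rewrite PE// mulrA -RintegralZl//; last first.
  exact: (laplace_moment_integrable mA Afin (@mu_u A) u_bound).
by apply: eq_Rintegral => t _; rewrite expr0 mul1r mulrA.
Qed.

(** The second derivative is a positive factor times [H 0], and at each point some function of the
    chain [H] is nonzero. It thus has a sign on each side of every point, and the parity count
    applies. *)
Let inflection_points_parity (ea : bool) lo hi : 0 < lo -> lo <= hi ->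
  has_sign ea (H 0 lo) -> has_sign false (H 0 hi) ->
  exists2 m, odd m = ea & (inflection_points P lo hi #= `I_m)%card.
Proof.
move=> lo0 lohi Hlo Hhi.
pose w x := c * x `^ (p - 2).
have w0 x : 0 < x -> 0 < w x by move=> x0; rewrite mulr_gt0// powR_gt0.
have sgnF b x : 0 < x -> has_sign b (H 0 x) -> has_sign b (derive1n 2 P x).
  move=> x0 Hx; rewrite derive2P// -[b]addFb; apply: has_signM => //.
  by rewrite /has_sign expr0 mul1r; exact: w0.
have dH k (x : R) := laplace_chain_derive mA Afin (@mu_u A) u_bound p k x.
have Fc x : lo <= x <= hi -> {for x, continuous (derive1n 2 P)}.
  move=> xlh; have x0 : 0 < x by lra.
  have cpow : {for x, continuous (fun y : R => y `^ (p - 2))}.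
    have := is_derive1_powR (p - 2) x0 => ?.
    by apply/differentiable_continuous/derivable1_diffP.
  have cH : {for x, continuous (H 0)}.
    have := dH 0%N x => ?.
    by apply/differentiable_continuous/derivable1_diffP.
  have cG : (fun y => w y * H 0 y) y @[y --> x] --> w x * H 0 x.
    by apply: cvgM; [apply: cvgM; [exact: cvg_cst|exact: cpow]|exact: cH].
  suff : derive1n 2 P y @[y --> x] --> derive1n 2 P x by [].
  rewrite (derive2P x0); apply: cvg_trans cG; apply: near_eq_cvg.
  by near=> y; rewrite derive2P//; near: y; exact: lt_nbhsr.
have Fs x : lo <= x <= hi -> exists bl br, two_sided_sign (derive1n 2 P) x bl br.
  move=> xlh; have x0 : 0 < x by lra.
  have [k Hk] := laplace_chain_neq0 mA Afin (@mu_u A) u_bound p (L_gt0^~ x).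
  have [bl [br [e e0 [Hl Hr]]]] := two_sided_sign_derivatives dH Hk.
  (* Cutting the radius at [x] keeps the neighbourhood among positive SNRs, where [derive2P]
     holds. *)
  have [? ?] : Num.min e x <= e /\ Num.min e x <= x by rewrite !ge_min !lexx orbT.
  exists bl, br, (Num.min e x); first by rewrite lt_min e0.
  by split=> y yx; apply: sgnF; [lra|apply: Hl; lra|lra|apply: Hr; lra].
have [m om cm] := sign_changes_parity lohi Fc Fs (sgnF _ _ lo0 Hlo)
  (sgnF _ _ (lt_le_trans lo0 lohi) Hhi).
by exists m; [rewrite om addbF|exact: cm].
Unshelve. all: by end_near. Qed.

Local Notation lo12 := ((n%:R + q) / rho ^+ 2).
Local Notation lo3 := ((n%:R - q) / rho ^+ 2).
Local Notation d := (enorm (s i - s j)).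

Let d_gt0 : 0 < d. Proof. exact: dist_gt0. Qed.

Let d_lt_rho : d < rho.
Proof. by rewrite ltrDl; exact: dmax_gt0 ij. Qed.

Let rho2_gt0 : 0 < rho ^+ 2.
Proof. by rewrite exprn_gt0// (lt_trans d_gt0). Qed.

Let low_le a x t : 0 < x <= a / rho ^+ 2 -> A t -> 2 * (x * u t) <= a.
Proof.
move=> /andP[x0]; rewrite ler_pdivlMr// twice_mul_u => xa At.
apply: le_trans xa; rewrite ler_pM2l// lerXn2r ?nnegrE ?enorm_ge0 ?A_dmax//.
exact: le_trans (enorm_ge0 _) (A_dmax At).
Qed.

(** Strict because [d < rho]; this provides the strict sign required by [H_has_sign] at the lower
    end. *)
Let low_lt a : 0 < a -> 2 * (a / rho ^+ 2 * (enorm (s j - s i) ^+ 2 / 2)) < a.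
Proof.
move=> a0; rewrite (enormB (s j)) twice_mul_half.
by rewrite mulrAC ltr_pdivrMr// ltr_pM2l// ltrXn2r ?nnegrE ?(ltW d_gt0) ?(ltW (lt_trans d_gt0 d_lt_rho)).
Qed.

Let hi_sign : has_sign false (H 0 hi).
Proof.
have dmd := dmin_lt_dist s_inj ij; have dm0 := dmin_gt0 s_inj ij.
apply: H_has_sign => [t At|]; rewrite expr0 mul1r.
  apply: high_snr_ge0; rewrite twice_mul_u mulrAC ler_pdivlMr//.
  rewrite ler_wpM2l ?addr_ge0 ?sqrtr_ge0//.
  by rewrite lerXn2r ?nnegrE ?enorm_ge0 ?(ltW dm0) ?A_dmin.
apply: high_snr_gt0.
rewrite (enormB (s j)) twice_mul_half.
rewrite mulrAC ltr_pdivlMr// ltr_pM2l; last by rewrite ltr_wpDr ?sqrtr_ge0.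
by rewrite ltrXn2r ?nnegrE ?(ltW dm0) ?(ltW d_gt0).
Qed.

Let lo_le_hi a : 0 < a -> a <= n%:R + q -> a / rho ^+ 2 <= hi.
Proof.
move=> a0 aq; have dmd := dmin_lt_dist s_inj ij; have dm0 := dmin_gt0 s_inj ij.
rewrite ler_pM ?(ltW a0) ?invr_ge0 ?(ltW rho2_gt0)// lef_pV2 ?posrE//.
have ltr := lt_trans dmd d_lt_rho.
by rewrite lerXn2r ?nnegrE ?(ltW dm0) ?(ltW (lt_trans dm0 ltr))// ltW.
Qed.

Let low_interval a : is_interval [set x : R | 0 < x <= a].
Proof.
move=> x y /= /andP[x0 _] /andP[_ ya] z /andP[xz zy].
by rewrite (lt_le_trans x0 xz) (le_trans zy ya).
Qed.

Lemma pep_concave_low_dim : (n <= 2)%N -> concave_function [set x | 0 < x <= lo12] P.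
Proof.
move=> n2; rewrite /concave_function.
rewrite (_ : \- P = fun x => (-1) * P x); last by apply/funext => x; rewrite mulN1r.
apply: convexP => //.
  by move=> x /andP[].
move=> x t /= hx At; rewrite mulN1r oppr_ge0; apply: low_dim_snr_le0 => //.
  have /andP[x0 _] := hx; have /andP[u0 _] := u_bound At.
  by rewrite mulr_ge0// ltW.
exact: low_le hx At.
Qed.

(** The second derivative is negative at the lower end and positive at the upper end. *)
Lemma pep_inflections_low_dim : (n <= 2)%N ->
  exists2 m, odd m & (inflection_points P lo12 hi #= `I_m)%card.
Proof.
move=> n2; have nq0 : 0 < n%:R + q by rewrite ltr_wpDr ?sqrtr_ge0.
have lo0 : 0 < lo12 by rewrite divr_gt0.
have sl : has_sign true (H 0 lo12).
  apply: H_has_sign => [t At|]; rewrite expr1 mulN1r ?oppr_ge0 ?oppr_gt0.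
    apply: low_dim_snr_le0 => //; last by apply: low_le => //; rewrite lo0/=.
    by have /andP[u0 _] := u_bound At; rewrite mulr_ge0// ltW.
  apply: low_dim_snr_lt0 => //; last exact: low_lt.
  by rewrite mulr_gt0// divr_gt0// exprn_gt0// (enormB (s j)).
have [m om cm] := inflection_points_parity lo0 (lo_le_hi nq0 (lexx _)) sl hi_sign.
by exists m.
Qed.

Lemma pep_convex_low : (2 < n)%N ->
  convex_function (E := R^o) [set x | 0 < x <= lo3] P.
Proof.
move=> n2; rewrite (_ : P = fun x => 1 * P x); last by apply/funext => x; rewrite mul1r.
apply: convexP => //.
  by move=> x /andP[].
by move=> x t /= hx At; rewrite mul1r; apply: low_snr_ge0; exact: low_le hx At.
Qed.

(** The second derivative is positive at both ends; [2 < n] makes the lower end a positive SNR. *)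
Lemma pep_inflections_high_dim : (2 < n)%N ->
  exists2 m, ~~ odd m & (inflection_points P lo3 hi #= `I_m)%card.
Proof.
move=> n2; have nq0 : 0 < n%:R - q by rewrite subr_gt0 sqrt_lt_dim.
have lo0 : 0 < lo3 by rewrite divr_gt0.
have sl : has_sign false (H 0 lo3).
  apply: H_has_sign => [t At|]; rewrite expr0 mul1r.
    by apply: low_snr_ge0; apply: low_le => //; rewrite lo0/=.
  by apply: low_snr_gt0; exact: low_lt.
have nqq : n%:R - q <= n%:R + q by have := sqrtr_ge0 (2 * n%:R : R); lra.
have [m om cm] := inflection_points_parity lo0 (lo_le_hi nq0 nqq) sl hi_sign.
by exists m => //; rewrite om.
Qed.

End bounded_region.
End pairwise_error_probability.

(** Boundedness of the region of [s j] makes [dmax s j] a genuine bound on distances within it, and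
    the low SNR sets keep only positive SNRs. *)
Theorem theorem3 (R : realType) (n M : nat) (s : 'I_M -> 'rV[R]_n)
    (i j : 'I_M) (n_ge1 : (1 <= n)%N) (M_ge2 : (2 <= M)%N)
    (s_inj : injective s)
    (s_energy : M%:R^-1 * \sum_k enorm (s k) ^+ 2 = 1)
    (neq_ij : i != j) :
  let P := pep s i j in
  let dij := enorm (s i - s j) in
  let hi := (n%:R + Num.sqrt (2 * n%:R)) / dmin s i ^+ 2 in
  let lo12 := (n%:R + Num.sqrt (2 * n%:R)) / (dij + dmax s j) ^+ 2 in
  let lo3 := (n%:R - Num.sqrt (2 * n%:R)) / (dij + dmax s j) ^+ 2 in
  [/\ convex_function (E := R^o) [set gamma | hi <= gamma] P,
      (n <= 2)%N -> bounded_set (voronoi s j) ->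
        concave_function [set gamma | 0 < gamma <= lo12] P /\
        exists2 m, odd m & (inflection_points P lo12 hi #= `I_m)%card
    & (2 < n)%N -> bounded_set (voronoi s j) ->
        convex_function (E := R^o) [set gamma | 0 < gamma <= lo3] P /\
        exists2 m, ~~ odd m & (inflection_points P lo3 hi #= `I_m)%card].
Proof.
split.
- exact: pep_convex_high.
- by move=> n2 bV; split; [exact: pep_concave_low_dim|exact: pep_inflections_low_dim].
- by move=> n2 bV; split; [exact: pep_convex_low|exact: pep_inflections_high_dim].
Qed.
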